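(* Let $\mathcal{G}_{n,m}$ and $\mathcal{G}_{n,m}^\perp$ ($n\in\{8,9,10,11,12\}$, $m\ge1$) be the codes described in the context. Then: (i) $\mathcal{G}_{12,1}=[12,6,6]_33$ is a $(3,4)$-PMCF code and, for each $m\ge6$, $\mathcal{G}_{12,m}=[12,6,6]_{3^m}6$ is a $(6,\lambda_{12,m})$-APMCF code for some $\lambda_{12,m}$; $\mathcal{G}_{11,1}=[11,6,5]_32$ is $(2,1)$-PMCF and, for each $m\ge4$, $\mathcal{G}_{11,m}=[11,6,5]_{3^m}5$ is $(5,\lambda_{11,m})$-APMCF for some $\lambda_{11,m}$; $\mathcal{G}_{10,1}=[10,6,4]_32$ is $(2,3)$-PMCF and, for each $m\ge3$, $\mathcal{G}_{10,m}=[10,6,4]_{3^m}4$ is $(4,\lambda_{10,m})$-APMCF for some $\lambda_{10,m}$, with $\lambda_{10,3}=180$; $\mathcal{G}_{9,1}=[9,6,3]_32$ is $(2,9)$-APMCF and, for each $m\ge2$, $\mathcal{G}_{9,m}=[9,6,3]_{3^m}3$ is $(3,\lambda_{9,m})$-APMCF for some $\lambda_{9,m}$, with $\lambda_{9,2}=\lambda_{9,3}=72$; $\mathcal{G}_{8,1}=[8,6,2]_31$ is $(1,2)$-PMCF and, for each $m\ge2$, $\mathcal{G}_{8,m}=[8,6,2]_{3^m}2$ is $(2,\lambda_{8,m})$-APMCF for some $\lambda_{8,m}$, with $\lambda_{8,2}=\lambda_{8,3}=24$. (ii) The following codes are APMCF but not UPWS: $\mathcal{G}_{11,2}=[11,6,5]_94$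 is $(4,30)$-APMCF; $\mathcal{G}_{10,1}^\perp=[10,4,6]_35$ is $(5,36)$-APMCF; $\mathcal{G}_{10,2}^\perp=[10,4,6]_96$ is $(6,180)$-APMCF; $\mathcal{G}_{9,1}^\perp=[9,3,6]_35$ is $(5,18)$-APMCF; $\mathcal{G}_{9,2}^\perp=[9,3,6]_96$ is $(6,72)$-APMCF; $\mathcal{G}_{8,1}^\perp=[8,2,6]_35$ is $(5,8)$-APMCF; $\mathcal{G}_{8,2}^\perp=[8,2,6]_96$ is $(6,24)$-APMCF.
   Context: An $[n,k,d]_qR$ code is a linear $k$-dimensional subspace of $\mathbb{F}_q^n$ with minimum distance $d$ and covering radius $R$. For a linear code $C$ over $\mathbb{F}_q$ with parity check matrix $H$, its $m$-lifted code $C_m$ ($m\ge1$) is $\{x\in\mathbb{F}_{q^m}^n:Hx^T=0\}$ (the $\mathbb{F}_{q^m}$-span of $C$). $B_j(v,C)$ is the number of codewords at Hamming distance $j$ from $v$. Vectors $v$ with $d(v,C)=R$ are farthest-off points. $C$ is an $(R,\lambda)$-APMCF code (almost perfect multiple covering of the farthest-off points) if $B_R(v,C)=\lambda$ for all $v$ with $d(v,C)=R$; if moreover $d\ge2R$, it is $(R,\lambda)$-PMCF. A code with covering radius $R$ is UPWS if there exist rationals $\beta_0,\dots,\beta_R$ with $\sum_{j}\beta_jB_j(v,C)=1$ for all $v$. $\mathcal{G}_{11}$ is the ternary Golay $[11,6,5]_3$ code with generator matrix $[I_6\mid M_{11}]$, $M_{11}=\begin{pmatrix}2&2&2&2&2\\2&2&1&1&0\\2&1&2&0&1\\1&2&0&2&1\\1&0&2&1&2\\0&1&1&2&2\end{pmatrix}$;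 $\mathcal{G}_{12}$ is the extended ternary Golay $[12,6,6]_3$ code with generator matrix $[I_6\mid M_{12}]$, $M_{12}=\begin{pmatrix}0&1&1&1&1&1\\1&0&1&2&2&1\\1&1&0&1&2&2\\1&2&1&0&1&2\\1&2&2&1&0&1\\1&1&2&2&1&0\end{pmatrix}$; $\mathcal{G}_{10},\mathcal{G}_9,\mathcal{G}_8$ are obtained from $\mathcal{G}_{11}$ by deleting coordinates $\{11\}$, $\{10,11\}$, $\{9,10,11\}$. $\mathcal{G}_n^\perp$ is the dual of $\mathcal{G}_n$. $\mathcal{G}_{n,m}$ and $\mathcal{G}_{n,m}^\perp$ are the $m$-lifted codes of $\mathcal{G}_n$ and $\mathcal{G}_n^\perp$ over $\mathbb{F}_{3^m}$, with $\mathcal{G}_{n,1}=\mathcal{G}_n$. *)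

(* Defs.v *)
From HB Require Import structures.
From mathcomp Require Import all_boot all_order all_algebra.

Set Implicit Arguments.
Unset Strict Implicit.
Unset Printing Implicit Defensive.

Import GRing.Theory.
Local Open Scope ring_scope.

Definition hdist (F : finFieldType) n (u v : 'rV[F]_n) : nat :=
  #|[set i | u 0 i != v 0 i]|.

(* In the two minima below the neutral element n is harmless: Hamming distances
   never exceed n, and the minima are over nonempty ranges, except for the
   minimum distance of the zero code. *)
Definition min_dist (F : finFieldType) n (C : {vspace 'rV[F]_n}) : nat :=
  \big[minn/n]_(p : 'rV[F]_n * 'rV[F]_n | [&& p.1 \in C, p.2 \in C & p.1 != p.2])
    hdist p.1 p.2.

Definition dist_to (F : finFieldType) n (v : 'rV[F]_n) (C : {vspace 'rV[F]_n}) : nat :=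
  \big[minn/n]_(c | c \in C) hdist v c.

Definition covering_radius (F : finFieldType) n (C : {vspace 'rV[F]_n}) : nat :=
  \max_(v : 'rV[F]_n) dist_to v C.

Definition code_params (F : finFieldType) n (C : {vspace 'rV[F]_n}) (k d R : nat) : Prop :=
  [/\ \dim C = k, min_dist C = d & covering_radius C = R].

Definition B (F : finFieldType) n (j : nat) (v : 'rV[F]_n) (C : {vspace 'rV[F]_n}) : nat :=
  #|[set c | (c \in C) && (hdist v c == j)]|.

Definition APMCF (F : finFieldType) n (C : {vspace 'rV[F]_n}) (R lambda : nat) : Prop :=
  covering_radius C = R /\
  forall v : 'rV[F]_n, dist_to v C = R -> B R v C = lambda.

Definition PMCF (F : finFieldType) n (C : {vspace 'rV[F]_n}) (R lambda : nat) : Prop :=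
  APMCF C R lambda /\ (2 * R <= min_dist C)%N.

Definition UPWS (F : finFieldType) n (C : {vspace 'rV[F]_n}) : Prop :=
  exists beta : 'I_(covering_radius C).+1 -> rat,
    forall v : 'rV[F]_n, \sum_j beta j * (B j v C)%:R = 1.

Definition code_of (F : finFieldType) k n (G : 'M[F]_(k, n)) : {vspace 'rV[F]_n} :=
  <<[seq row i G | i : 'I_k]>>%VS.

Definition null_code (F : finFieldType) r n (H : 'M[F]_(r, n)) : {vspace 'rV[F]_n} :=
  lker (linfun (mulmx H \o trmx)).

Lemma mem_null_code (F : finFieldType) r n (H : 'M[F]_(r, n)) x :
  (x \in null_code H) = (H *m x^T == 0).
Proof. by rewrite memv_ker lfunE. Qed.

Definition dual (F : finFieldType) n (C : {vspace 'rV[F]_n}) : {vspace 'rV[F]_n} :=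
  (\bigcap_(c : 'rV[F]_n | c \in C) null_code c)%VS.

Definition parity_check_mx (F : finFieldType) n (C : {vspace 'rV[F]_n}) :
    'M[F]_(\dim (dual C), n) :=
  \matrix_(i < \dim (dual C)) (vbasis (dual C))`_i.

Definition lifted (K L : finFieldType) (iota : {rmorphism K -> L}) n
    (C : {vspace 'rV[K]_n}) : {vspace 'rV[L]_n} :=
  null_code (map_mx iota (parity_check_mx C)).

Lemma null_code_submx (F : finFieldType) r s n (H : 'M[F]_(r, n)) (H' : 'M[F]_(s, n)) :
  (null_code H' <= null_code H)%VS = (H <= H')%MS.
Proof.
apply/subvP/idP => [sub | /submxP[D ->] x].
  rewrite submxE; apply/eqP/matrixP => i j.
  have /sub : (col j (cokermx H'))^T \in null_code H'.
    by rewrite mem_null_code trmxK colE mulmxA mulmx_coker mul0mx.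
  by rewrite mem_null_code trmxK colE mulmxA -colE => /eqP/colP/(_ i); rewrite !mxE.
by rewrite !mem_null_code -mulmxA => /eqP ->; rewrite mulmx0.
Qed.

Lemma mem_dualP (F : finFieldType) n (C : {vspace 'rV[F]_n}) x :
  reflect (forall c, c \in C -> c *m x^T = 0) (x \in dual C).
Proof.
rewrite memvE; apply: (iffP subv_bigcapP) => Cx c /Cx.
  by rewrite -memvE mem_null_code => /eqP.
by rewrite -memvE mem_null_code => ->.
Qed.

Lemma null_code_parity_check_mx (F : finFieldType) n (C : {vspace 'rV[F]_n}) :
  null_code (parity_check_mx C) = C.
Proof.
apply/eqP; rewrite eqEsubv; apply/andP; split; apply/subvP => x; last first.
  move=> Cx; rewrite mem_null_code; apply/eqP/row_matrixP => i.
  rewrite row0 row_mul rowK -[LHS]trmxK trmx_mul trmxK.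
  have /mem_dualP-> //: (vbasis (dual C))`_i \in dual C; last exact: trmx0.
  by rewrite vbasis_mem ?mem_nth ?size_tuple.
rewrite mem_null_code => /eqP Hx.
pose A := \matrix_(i < \dim C) (vbasis C)`_i.
have mC i : (vbasis C)`_i \in C.
  have [lt_i|le_i] := ltnP i (\dim C); last by rewrite nth_default ?size_tuple ?mem0v.
  by rewrite vbasis_mem ?mem_nth ?size_tuple.
have /submxP[D ->] : (x <= A)%MS.
  rewrite -null_code_submx; apply/subvP => y; rewrite !mem_null_code => /eqP Ay.
  have dy : y \in dual C.
    apply/mem_dualP => c /coord_vbasis ->; rewrite mulmx_suml big1 // => i _.
    by rewrite -scalemxAl -(rowK (fun i : 'I_ _ => (vbasis C)`_i)) -row_mul Ay row0 scaler0.
  rewrite (coord_vbasis dy) linear_sum mulmx_sumr big1 // => i _.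
  rewrite linearZ /= -scalemxAr -[x *m _]trmxK trmx_mul trmxK.
  rewrite -(rowK (fun i : 'I_ _ => (vbasis (dual C))`_i)) -row_mul.
  by rewrite Hx row0 trmx0 scaler0.
rewrite mulmx_sum_row memv_suml // => i _.
by rewrite memvZ // rowK mC.
Qed.

(* The lifted code does not depend on the choice of a parity check matrix. *)
Lemma lifted_parity_check (K L : finFieldType) (iota : {rmorphism K -> L}) n
    (C : {vspace 'rV[K]_n}) r (H : 'M[K]_(r, n)) :
  null_code H = C -> null_code (map_mx iota H) = lifted iota C.
Proof.
rewrite -{1}(null_code_parity_check_mx C) => eqH; apply/eqP.
by rewrite eqEsubv /lifted !null_code_submx !map_submx -!null_code_submx eqH subvv.
Qed.

Definition puncture (F : finFieldType) n s (C : {vspace 'rV[F]_(n + s)}) :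
    {vspace 'rV[F]_n} :=
  (linfun lsubmx @: C)%VS.

Definition mx_of_rows k n (s : seq (seq nat)) : 'M['F_3]_(k, n) :=
  \matrix_(i < k, j < n) (nth 0%N (nth [::] s i) j)%:R.

Definition M11 : 'M['F_3]_(6, 5) := mx_of_rows 6 5
  [:: [:: 2; 2; 2; 2; 2];
      [:: 2; 2; 1; 1; 0];
      [:: 2; 1; 2; 0; 1];
      [:: 1; 2; 0; 2; 1];
      [:: 1; 0; 2; 1; 2];
      [:: 0; 1; 1; 2; 2]]%N.

Definition M12 : 'M['F_3]_(6, 6) := mx_of_rows 6 6
  [:: [:: 0; 1; 1; 1; 1; 1];
      [:: 1; 0; 1; 2; 2; 1];
      [:: 1; 1; 0; 1; 2; 2];
      [:: 1; 2; 1; 0; 1; 2];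
      [:: 1; 2; 2; 1; 0; 1];
      [:: 1; 1; 2; 2; 1; 0]]%N.

Definition G12 : {vspace 'rV['F_3]_12} := code_of (row_mx 1%:M M12).
Definition G11 : {vspace 'rV['F_3]_11} := code_of (row_mx 1%:M M11).
Definition G10 : {vspace 'rV['F_3]_10} := @puncture _ 10 1 G11.
Definition G9 : {vspace 'rV['F_3]_9} := @puncture _ 9 2 G11.
Definition G8 : {vspace 'rV['F_3]_8} := @puncture _ 8 3 G11.

(* Main.v *)
(* Write a vector over the field with 3^m elements as an m x n ternary matrix A,
   through a basis over the prime field. The words of the lifted code are then
   the matrices X G, G a generator matrix of the ternary code, and distances
   count the nonzero columns of A - X G.

   If the covering radius reaches the redundancy bound n - k, a word at distance
   n - k from a farthest-off point v agrees with v exactly on an information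
   set, and every information set arises from exactly one such word. So lambda
   is the number of information sets, which is that of the ternary code. The
   bound is reached at A if every set of n - k - 1 coordinates is avoided by some
   dual word that is not orthogonal to A; such an A with few rows exists for each
   code, and it can be padded with zero rows.

   The other codes live over fields with 3 or 9 elements and are settled by
   enumerating cosets; over 9 elements, row operations on the two rows of A
   reduce the enumeration to pairs in reduced echelon form. The failure of UPWS
   is a linear inconsistency between the weight distributions of a few cosets. *)

From HB Require Import structures.
From mathcomp Require Import all_boot all_order all_algebra.
From mathcomp Require Import zify finfield.
Require Import Defs.

Set Implicit Arguments.
Unset Strict Implicit.
Unset Printing Implicit Defensive.

Import Order.TTheory GRing.Theory Num.Theory.
Local Open Scope ring_scope.

(** * Distances and information sets *)

Section MinimumDistance.
Variables (F : finFieldType) (n : nat).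
Implicit Types (C : {vspace 'rV[F]_n}) (u v c : 'rV[F]_n).

Lemma hdist_leq u v : (hdist u v <= n)%N.
Proof. by rewrite -[leqRHS]card_ord max_card. Qed.

Lemma dist_to_leq v c C : c \in C -> (dist_to v C <= hdist v c)%N.
Proof.
by move=> Cc; rewrite /dist_to -minEnat; exact: (bigmin_le_cond n (hdist v) Cc).
Qed.

(** The bound on [w] reflects that the minimum in [dist_to] starts from the neutral element n. *)
Lemma leq_dist_to v C w : (w <= n)%N ->
  (w <= dist_to v C)%N = [forall c in C, w <= hdist v c]%N.
Proof.
move=> w_n; rewrite /dist_to -minEnat; apply/idP/forall_inP => [le_w c Cc|le_w].
  exact: leq_trans le_w (dist_to_leq v Cc).
by apply/(@bigmin_geP _ _ _ n w (fun c => c \in C) (hdist v)).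
Qed.

Lemma covering_radiusE C R :
  (forall v, dist_to v C <= R)%N -> (exists v, R <= dist_to v C)%N ->
  covering_radius C = R.
Proof.
move=> le_R [v le_v]; apply/eqP; rewrite eqn_leq; apply/andP; split.
  exact/bigmax_leqP.
exact: leq_trans le_v (leq_bigmax v).
Qed.

(** By linearity the distance of two codewords is the weight of their difference. *)
Lemma min_distE C d :
  (forall c, c \in C -> c != 0 -> (d <= hdist c 0%R)%N) ->
  (exists2 c, c \in C & (c != 0) && (hdist c 0 == d)) ->
  min_dist C = d.
Proof.
move=> le_d [c Cc /andP[c0 /eqP cd]].
have hdistE (u v : 'rV[F]_n) : hdist u v = hdist (u - v) 0%R.
  by apply: eq_card => i; rewrite !inE !mxE subr_eq0.
apply/eqP; rewrite eqn_leq /min_dist -minEnat; apply/andP; split.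
  rewrite -cd; apply: (bigmin_le_cond n (fun p => hdist p.1 p.2) (j := (c, 0))).
  by rewrite Cc mem0v.
apply/(@bigmin_geP _ _ _ n d _ (fun p : 'rV[F]_n * 'rV[F]_n => hdist p.1 p.2)).
split; first by rewrite -cd; exact: hdist_leq.
by case=> a b /and3P[/= Ca Cb ab]; rewrite hdistE; apply: le_d; rewrite ?rpredB ?subr_eq0.
Qed.

End MinimumDistance.

Section InformationSets.
Variables (F : finFieldType) (n : nat) (C : {vspace 'rV[F]_n}).

(** This says that restriction to J is injective on C; with |J| = dim C it is the usual notion of
    information set. *)
Definition info_set (J : {set 'I_n}) : bool :=
  [forall c in C, [forall i in J, c 0 i == 0] ==> (c == 0)].

Definition num_info_sets : nat :=
  #|[set J : {set 'I_n} | (#|J| == \dim C) && info_set J]|.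

Let agree (v c : 'rV[F]_n) : {set 'I_n} := [set i | v 0 i == c 0 i].

Let card_agree v c : (#|agree v c| + hdist v c = n)%N.
Proof.
rewrite -[RHS]card_ord -(cardsC (agree v c)); congr (_ + _)%N.
by apply: eq_card => i; rewrite !inE.
Qed.

(** Restriction to J is injective on C, and C has as many words as there are functions from J to F,
    so it is also onto. *)
Lemma info_set_interpolation (J : {set 'I_n}) (v : 'rV[F]_n) :
  #|J| = \dim C -> info_set J -> exists2 c, c \in C & J \subset agree v c.
Proof.
move=> cardJ infoJ.
(* Functions on J are extended by zero, so that the target is a [pffun_on] of known cardinality. *)
pose f (c : 'rV[F]_n) := [ffun i => if i \in J then c 0 i else 0].
have f_inj : {in C &, injective f}.
  move=> c c' Cc Cc' /ffunP eq_f; apply/eqP; rewrite -subr_eq0.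
  have /forall_inP/(_ (c - c')) := infoJ; rewrite rpredB // => /(_ isT)/implyP; apply.
  apply/forall_inP => i Ji; move: (eq_f i); rewrite !ffunE Ji !mxE => ->.
  by rewrite subrr.
have sub_im : f @: [set c | c \in C] \subset [set g in pffun_on 0 J predT].
  apply/subsetP => _ /imsetP[c _ ->]; rewrite inE; apply/pffun_onP; split=> //.
  by apply/supportP => i /negPf nJi; rewrite ffunE nJi.
have /setP/(_ (f v)) : f @: [set c | c \in C] = [set g in pffun_on 0 J predT].
  apply/eqP; rewrite eqEcard sub_im card_in_imset; last first.
    by move=> c c' /[!inE]; exact: f_inj.
  rewrite !cardsE card_pffun_on card_vspace cardJ.
  by rewrite (@eq_card _ predT F) ?leqnn.
rewrite [f v \in [set _ in _]]inE.
have -> : f v \in pffun_on 0 J predT.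
  by apply/pffun_onP; split=> //; apply/supportP => i /negPf nJi; rewrite ffunE nJi.
case/imsetP => c /[!inE] Cc /ffunP eq_f; exists c => //.
by apply/subsetP => i Ji; move: (eq_f i); rewrite !ffunE Ji inE => ->.
Qed.

(* A codeword at the maximal conceivable distance n - k from v agrees with v
   exactly on an information set: a nonzero codeword vanishing there could be
   used to gain one more agreement. *)
Lemma B_redundancy (v : 'rV[F]_n) :
  dist_to v C = (n - \dim C)%N -> B (n - \dim C) v C = num_info_sets.
Proof.
move=> dist_v.
have k_n : (\dim C <= n)%N.
  by have := dimvS (subvf C); rewrite dimvf /dim /= mul1n.
have card_agreeC c : c \in C -> (#|agree v c| <= \dim C)%N.
  move=> /(dist_to_leq v); rewrite dist_v; have := card_agree v c; lia.
have cardJ c : hdist v c = (n - \dim C)%N -> #|agree v c| = \dim C.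
  by have := card_agree v c; lia.
have infoJ c : c \in C -> hdist v c = (n - \dim C)%N -> info_set (agree v c).
  move=> Cc dc; apply/forall_inP => c' Cc'; apply/implyP => /forall_inP c'0.
  apply/eqP/rowP => i; rewrite mxE; apply: contraTeq isT => c'i.
  (* This multiple of c' corrects c at i; the old agreements survive because c' vanishes there. *)
  have Ccc : c + ((v 0 i - c 0 i) / c' 0 i) *: c' \in C by rewrite rpredD ?rpredZ.
  have := card_agreeC _ Ccc; rewrite leqNgt -(cardJ c dc) => /negP[].
  apply: proper_card; apply/properP; split.
    apply/subsetP => j Jj; move: (Jj) (c'0 j Jj); rewrite !inE !mxE => + /eqP->.
    by rewrite mulr0 addr0.
  exists i; first by rewrite inE !mxE divfK // addrC subrK.
  by apply: contra c'i => /c'0.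
(* Taking agreement sets is a bijection onto the information sets: interpolation gives surjectivity,
   and two words with the same agreement set differ by a codeword vanishing on an information
   set. *)
rewrite /B /num_info_sets -(card_in_imset (f := agree v)).
  apply: eq_card => J; apply/imsetP/idP.
    by case=> c /[!inE] /andP[Cc /eqP dc] ->; rewrite cardJ // eqxx infoJ.
  rewrite inE => /andP[/eqP card_J info_J].
  have [c Cc sub_c] := info_set_interpolation v card_J info_J.
  have eqJ : agree v c = J.
    by apply/esym/eqP; rewrite eqEcard sub_c card_J card_agreeC.
  by exists c => //; rewrite inE Cc; have := card_agree v c; rewrite eqJ card_J; lia.
move=> c c' /[!inE] /andP[Cc /eqP dc] /andP[Cc' /eqP dc'] eq_agr; apply/eqP.
rewrite -subr_eq0; have /forall_inP/(_ (c - c')) := infoJ c Cc dc.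
rewrite rpredB // => /(_ isT)/implyP; apply; apply/forall_inP => i ci.
move: ci (ci); rewrite {2}eq_agr !inE !mxE => /eqP <- /eqP <-; exact/eqP/subrr.
Qed.
End InformationSets.

(** * Lifted codes as matrix codes *)

Section ColumnSupport.
Variables (F : fieldType) (n : nat).

Definition col_supp m (A : 'M[F]_(m, n)) : {set 'I_n} := [set i | col i A != 0].

Lemma col_supp_mulmx m r (P : 'M_(m, r)) (A : 'M_(r, n)) :
  col_supp (P *m A) \subset col_supp A.
Proof.
apply/subsetP => i; rewrite !inE !colE -mulmxA -colE; apply: contra => /eqP ->.
by rewrite mulmx0.
Qed.

Lemma col_supp_unitmx m (P : 'M_m) (A : 'M_(m, n)) :
  P \in unitmx -> col_supp (P *m A) = col_supp A.
Proof.
move=> unitP; apply/eqP; rewrite eqEsubset col_supp_mulmx.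
by rewrite -{1}(mulKmx unitP A) col_supp_mulmx.
Qed.

Lemma col_supp_col_mx m1 m2 (A : 'M_(m1, n)) (B : 'M_(m2, n)) :
  col_supp (col_mx A B) = col_supp A :|: col_supp B.
Proof.
by apply/setP => i; rewrite !inE col_col_mx col_mx_eq0 negb_and.
Qed.

Lemma col_supp_opp m (A : 'M_(m, n)) : col_supp (- A) = col_supp A.
Proof. by apply/setP => i; rewrite !inE linearN oppr_eq0. Qed.

Lemma col_supp_eq0 m (A : 'M_(m, n)) : (col_supp A == set0) = (A == 0).
Proof.
apply/eqP/eqP => [A0 | ->]; last by apply/setP => i; rewrite !inE linear0 eqxx.
apply/matrixP => i j; have /setP/(_ j) := A0.
by rewrite !inE => /negbFE/eqP/colP/(_ i); rewrite !mxE.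
Qed.

Lemma col_supp0 m : col_supp (0 : 'M_(m, n)) = set0.
Proof. by apply/eqP; rewrite col_supp_eq0. Qed.

(** Repeating a row m times embeds words over the small field into matrices; with m > 0 the row can
    be recovered, so no support is lost. *)
Lemma col_supp_const m (u : 'rV_n) : (0 < m)%N ->
  col_supp (const_mx 1 *m u : 'M_(m, n)) = col_supp u.
Proof.
move=> m0; apply/eqP; rewrite eqEsubset col_supp_mulmx.
have {1}-> : u = delta_mx 0 (Ordinal m0) *m (const_mx 1 *m u : 'M_(m, n)).
  rewrite -rowE row_mul row_const; apply/rowP => i.
  by rewrite !mxE big_ord1 !mxE mul1r.
exact: col_supp_mulmx.
Qed.

End ColumnSupport.

Section LiftedCode.
Variables (K L : finFieldType) (iota : {rmorphism K -> L}).

(** A basis of L over K is built greedily: r < m independent elements span at most |K|^r < |L|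
    elements, so some x lies outside their span. *)
Lemma ex_lift_basis m : #|L| = (#|K| ^ m)%N ->
  exists alpha : 'rV[L]_m, injective (fun a : 'cV[K]_m => alpha *m map_mx iota a).
Proof.
move=> cardL.
suff /(_ m (leqnn m))[alpha alpha0] : forall r, (r <= m)%N -> exists alpha : 'rV[L]_r,
    forall a : 'cV[K]_r, alpha *m map_mx iota a = 0 -> a = 0.
  exists alpha => a b eq_ab; apply/eqP; rewrite -subr_eq0; apply/eqP/alpha0.
  by rewrite map_mxB mulmxBr eq_ab subrr.
elim=> [|r IHr] lt_rm.
  by exists 0 => a _; apply/colP; case.
have [alpha alpha0] := IHr (ltnW lt_rm).
pose S := [set (alpha *m map_mx iota a) 0 0 | a : 'cV[K]_r].
have [x xS] : exists x, x \notin S.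
  apply/existsP; rewrite -negb_forall; apply/forallP => S1.
  have : (#|L| <= #|S|)%N by apply/subset_leq_card/subsetP.
  rewrite leqNgt => /negP[]; apply: leq_ltn_trans (leq_imset_card _ _) _.
  by rewrite cardL card_mx muln1 ltn_exp2l // card_finNzRing_gt1.
exists (row_mx x%:M alpha) => a.
have := vsubmxK (a : 'cV_(1 + r)).
move: (usubmx _) (dsubmx _) => b c <- {a}.
move=> eq0; have {eq0}: x%:M *m map_mx iota b + alpha *m map_mx iota c = 0.
  by rewrite -mul_row_col -map_col_mx.
move=> eq0.
have b0 : b = 0.
  apply/eqP; apply: contraR xS => b0; apply/imsetP.
  have {}b0 : b 0 0 != 0 by apply: contra b0 => /eqP b0;
    apply/eqP/matrixP => i j; rewrite !ord1 mxE.
  (* A relation with nonzero coefficient at x would put x in the span of the earlier elements. *)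
  exists (- (b 0 0)^-1 *: c) => //.
  have /matrixP/(_ 0 0) := eq0; rewrite map_mxZ -scalemxAr !mxE big_ord1 !mxE.
  move=> /eqP; rewrite mulr1n addrC addr_eq0 => /eqP ->.
  rewrite rmorphN fmorphV mulrN mulNr opprK mulrC mulfK //.
  by rewrite fmorph_eq0.
rewrite b0 map_mx0 mulmx0 add0r in eq0 *.
by rewrite (alpha0 _ eq0) col_mx0.
Qed.

Variables (m n k : nat) (C : {vspace 'rV[K]_n}) (G : 'M[K]_(k, n)).
Variable alpha : 'rV[L]_m.
Hypothesis alpha_inj : injective (fun a : 'cV[K]_m => alpha *m map_mx iota a).
Hypothesis cardL : #|L| = (#|K| ^ m)%N.
Hypothesis memC : forall x, reflect (exists u, x = u *m G) (x \in C).

(* The vector of L^n whose coordinates in the basis alpha of L over K are the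
   rows of A: its Hamming weight counts the nonzero columns of A. *)
Definition lift (A : 'M[K]_(m, n)) : 'rV[L]_n := alpha *m map_mx iota A.

Lemma lift_eq0 A i : (lift A 0 i == 0) = (i \notin col_supp A).
Proof.
rewrite inE negbK; have -> : lift A 0 i = (alpha *m map_mx iota (col i A)) 0 0.
  by rewrite !mxE; apply: eq_bigr => j _; rewrite !mxE.
apply/eqP/eqP => [eq_i | ->]; last by rewrite map_mx0 mulmx0 mxE.
by apply: alpha_inj; apply/matrixP => a b; rewrite !ord1 eq_i map_mx0 mulmx0 mxE.
Qed.

Lemma hdist_lift A A' : hdist (lift A) (lift A') = #|col_supp (A - A')|.
Proof.
apply: eq_card => i; rewrite -[RHS]negbK -lift_eq0 inE /lift.
by rewrite map_mxB mulmxBr !mxE subr_eq0.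
Qed.

Lemma lift_bij : bijective lift.
Proof.
apply: inj_card_bij => [A A' eqA|].
  apply/eqP; rewrite -subr_eq0 -col_supp_eq0 -cards_eq0 -hdist_lift eqA.
  by rewrite /hdist cards_eq0; apply/eqP/setP => i; rewrite !inE eqxx.
by rewrite !card_mx cardL mul1n expnM.
Qed.

(** The parity checks have entries in K, so independence of [alpha] splits the equation into one per
    row of A: each row must lie in C. *)
Lemma mem_lifted A : reflect (exists X, A = X *m G) (lift A \in lifted iota C).
Proof.
rewrite /lifted; set H := parity_check_mx C.
have memH x : (x \in C) = (H *m x^T == 0) by rewrite -mem_null_code null_code_parity_check_mx.
rewrite mem_null_code /lift trmx_mul mulmxA map_trmx -map_mxM.
apply: (iffP eqP) => [HA0 | [X ->]]; last first.
  have -> : H *m (X *m G)^T = 0; last by rewrite map_mx0 mul0mx.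
  rewrite trmx_mul mulmxA; suff -> : H *m G^T = 0 by rewrite mul0mx.
  apply/trmx_inj; rewrite trmx_mul trmxK trmx0; apply/row_matrixP => i.
  rewrite row0 row_mul; apply/trmx_inj; rewrite trmx_mul trmxK trmx0.
  by apply/eqP; rewrite -memH; apply/memC; exists (delta_mx 0 i); rewrite rowE.
have {}HA0 : H *m A^T = 0.
  apply/row_matrixP => i; rewrite row0; apply/trmx_inj/alpha_inj => /=.
  rewrite trmx0 map_mx0 mulmx0; apply/trmx_inj; rewrite trmx_mul trmx0 map_trmx trmxK.
  by rewrite map_row -row_mul HA0 row0.
have rowA i : exists u, row i A == u *m G.
  have /memC[u ->] : row i A \in C; last by exists u.
  by rewrite memH tr_row colE mulmxA HA0 mul0mx.
exists (\matrix_i (xchoose (rowA i))); apply/row_matrixP => i.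
rewrite row_mul rowK; move: (xchooseP (rowA i)) => /eqP; exact.
Qed.

(** Codewords of the lifted code are counted through their coefficient matrices X. The predicate on
    distances covers the cases at most R, less than R and exactly R at once. *)
Definition near_words (A : 'M[K]_(m, n)) (P : pred nat) : nat :=
  #|[set X : 'M_(m, k) | P #|col_supp (A - X *m G)|]|.

Hypothesis G_inj : forall u : 'rV_k, u *m G = 0 -> u = 0.

Lemma mulmxr_inj : injective (fun X : 'M_(m, k) => X *m G).
Proof.
move=> X Y eqXY; apply/eqP; rewrite -subr_eq0; apply/eqP/row_matrixP => i.
by rewrite row0; apply: G_inj; rewrite -row_mul mulmxBl eqXY subrr row0.
Qed.

Lemma B_lift j A : B j (lift A) (lifted iota C) = near_words A (pred1 j).
Proof.
rewrite /near_words -(card_imset _ (inj_comp (bij_inj lift_bij) mulmxr_inj)).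
apply: eq_card => c; rewrite inE; apply/andP/imsetP.
  have [g _ gK] := lift_bij; rewrite -(gK c) => -[/mem_lifted[X eqX]].
  by rewrite hdist_lift eqX => dX; exists X; rewrite ?inE.
case=> X /[!inE] dX -> /=; rewrite hdist_lift dX; split=> //.
by apply/mem_lifted; exists X.
Qed.

Lemma leq_dist_lift A w : (w <= n)%N ->
  (w <= dist_to (lift A) (lifted iota C))%N = (near_words A (fun d => d < w)%N == 0%N).
Proof.
move=> w_n; rewrite leq_dist_to // cards_eq0.
apply/forall_inP/eqP => [far | /setP far c].
  apply/setP => X; rewrite !inE -hdist_lift ltnNge far //.
  by apply/mem_lifted; exists X.
have [g _ gK] := lift_bij; rewrite -(gK c) => /mem_lifted[X eqX].
by rewrite hdist_lift eqX leqNgt; have := far X; rewrite !inE => ->.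
Qed.

(** By counting: the coefficient matrices number |K|^(mk) = |L|^k. *)
Lemma dim_lifted : (0 < m)%N -> \dim (lifted iota C) = k.
Proof.
move=> m0; apply: (@expnI #|L|); first by rewrite card_finNzRing_gt1.
rewrite -card_vspace cardL -expnM -card_mx.
rewrite -[RHS](card_imset _ (inj_comp (bij_inj lift_bij) mulmxr_inj)).
have [g _ gK] := lift_bij; apply: eq_card => c; apply/idP/imsetP => [|[X _ ->]].
  by rewrite -(gK c) => /mem_lifted[X ->]; exists X.
by apply/mem_lifted; exists X.
Qed.

(** Lifting keeps the minimum weight: the support of X G contains that of each row of X G, and a
    word of weight d can be repeated in all rows. *)
Lemma min_dist_lifted d : (0 < m)%N ->
  (forall u : 'rV_k, u != 0 -> (d <= #|col_supp (u *m G)|)%N) ->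
  (exists2 u : 'rV_k, u != 0 & #|col_supp (u *m G)| == d) ->
  min_dist (lifted iota C) = d.
Proof.
move=> m0 le_d [u u0 /eqP ud].
have lift0 : lift 0 = 0 by rewrite /lift map_mx0 mulmx0.
have hdist0 D : hdist (lift D) 0%R = #|col_supp D| by rewrite -lift0 hdist_lift subr0.
apply: min_distE => [c|].
  have [g _ gK] := lift_bij; rewrite -(gK c) => /mem_lifted[X eqX].
  rewrite hdist0 -lift0 (inj_eq (bij_inj lift_bij)) eqX => XG0.
  have [i ri] : exists i, row i X != 0.
    apply/existsP; apply: contraR XG0; rewrite negb_exists => /forallP X0.
    suff -> : X = 0 by rewrite mul0mx.
    by apply/row_matrixP => i; rewrite row0; apply/eqP; rewrite -[_ == _]negbK X0.
  apply: leq_trans (le_d _ ri) (subset_leq_card _).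
  by rewrite -row_mul rowE col_supp_mulmx.
exists (lift (const_mx 1 *m u *m G)).
  by apply/mem_lifted; exists (const_mx 1 *m u).
rewrite -{1}lift0 (inj_eq (bij_inj lift_bij)) hdist0 -mulmxA col_supp_const //.
rewrite ud eqxx andbT -col_supp_eq0 col_supp_const // col_supp_eq0.
by apply: contra u0 => /eqP/G_inj ->.
Qed.

Lemma covering_radius_lifted R :
  (forall A, 0 < near_words A (fun d => d <= R))%N ->
  (exists A, near_words A (fun d => d < R) == 0)%N ->
  covering_radius (lifted iota C) = R.
Proof.
move=> leR [A farA].
(* Were R > n, the choice X = 0 would already be nearer than R to the far point. *)
have RleN : (R <= n)%N.
  rewrite leqNgt; apply/negP => nR; move: farA; rewrite cards_eq0 => /eqP/setP/(_ 0).
  rewrite !inE => /negP[]; apply: leq_ltn_trans nR.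
  by rewrite -[leqRHS]card_ord max_card.
apply: covering_radiusE => [v|]; last by exists (lift A); rewrite leq_dist_lift.
have [g _ gK] := lift_bij; rewrite -(gK v).
have := leR (g v); rewrite card_gt0 => /set0Pn[X /[!inE]].
rewrite -hdist_lift; apply: leq_trans; apply: dist_to_leq.
by apply/mem_lifted; exists X.
Qed.

Lemma APMCF_lifted R lambda :
  (forall A, 0 < near_words A (fun d => d <= R))%N ->
  (exists A, near_words A (fun d => d < R) == 0)%N ->
  (forall A, near_words A (fun d => d < R) == 0 -> near_words A (pred1 R) = lambda)%N ->
  APMCF (lifted iota C) R lambda.
Proof.
move=> leR farR lambdaR; have covR := covering_radius_lifted leR farR.
split=> // v; have [g _ gK] := lift_bij; rewrite -(gK v) => distR.
rewrite B_lift lambdaR // -leq_dist_lift ?distR // -distR.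
have -> : dist_to (lift (g v)) (lifted iota C) = R by [].
apply: leq_trans (hdist_leq (lift (g v)) 0); rewrite -distR.
exact/dist_to_leq/mem0v.
Qed.

(** A lifted word vanishes on J exactly when all its rows do, so information sets depend only on the
    code over K. The condition is put as a count equal to 1 to suit list enumeration. *)
Lemma info_set_lifted (J : {set 'I_n}) : (0 < m)%N ->
  info_set (lifted iota C) J =
  (#|[set u : 'rV_k | [disjoint col_supp (u *m G) & J]]| == 1)%N.
Proof.
move=> m0.
apply/forall_inP/cards1P => [infoJ | [u0 /setP eq_u0] c].
  exists 0; apply/setP => u; rewrite !inE; apply/idP/eqP => [uJ | ->]; last first.
    by rewrite mul0mx col_supp0 disjoints_subset sub0set.
  pose X : 'M_(m, k) := const_mx 1 *m u.
  have suppX : col_supp (X *m G) = col_supp (u *m G) by rewrite -mulmxA col_supp_const.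
  have /infoJ/implyP : lift (X *m G) \in lifted iota C by apply/mem_lifted; exists X.
  have -> : [forall i in J, lift (X *m G) 0 i == 0].
    apply/forall_inP => i Ji; rewrite lift_eq0 suppX.
    by rewrite (disjointFl uJ Ji).
  move=> /(_ isT)/eqP X0; apply: G_inj; apply/eqP; rewrite -col_supp_eq0 -suppX.
  by apply/eqP/setP => i; rewrite in_set0; apply/negbTE; rewrite -lift_eq0 X0 mxE.
have {u0}eq_u0 (u : 'rV_k) : [disjoint col_supp (u *m G) & J] -> u = 0.
  have := eq_u0 0; rewrite !inE mul0mx col_supp0 disjoints_subset sub0set => /esym/eqP u00.
  by have := eq_u0 u; rewrite !inE -u00 => -> /eqP.
have [g _ gK] := lift_bij; rewrite -(gK c) => /mem_lifted[X ->].
apply/implyP => /forall_inP c0.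
suff -> : X = 0 by rewrite mul0mx /lift map_mx0 mulmx0.
apply/row_matrixP => i; rewrite row0; apply: eq_u0.
rewrite disjoint_sym disjoints_subset; apply/subsetP => j /c0; rewrite lift_eq0 in_setC.
by apply: contra; apply/subsetP; rewrite -row_mul rowE col_supp_mulmx.
Qed.

End LiftedCode.

(** * Symmetries of the distance counts and a criterion for far points *)

Section NearWords.
Variables (K : finFieldType) (m n k : nat) (G : 'M[K]_(k, n)).
Implicit Types (A : 'M[K]_(m, n)) (P : pred nat).

Lemma near_words_add A (U : 'M_(m, k)) P :
  near_words G (A + U *m G) P = near_words G A P.
Proof.
rewrite /near_words.
rewrite -(card_imset [set X : 'M[K]_(m, k) | P #|col_supp (A - X *m G)|] (addrI U)).
have suppU X : A + U *m G - (U + X) *m G = A - X *m G.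
  by rewrite mulmxDl opprD addrA addrK.
apply: eq_card => X; rewrite inE; apply/idP/imsetP => [PX | [Y /[!inE] PY ->]].
  have eqX : U + (X - U) = X by rewrite addrC subrK.
  by exists (X - U); rewrite // inE -suppU eqX.
by rewrite suppU.
Qed.

(** An invertible row operation preserves column supports, and X -> D X permutes the coefficient
    matrices. *)
Lemma near_words_unitmx A (D : 'M_m) P : D \in unitmx ->
  near_words G (D *m A) P = near_words G A P.
Proof.
move=> unitD; have mulD_inj : injective (mulmx D : 'M[K]_(m, k) -> _).
  exact: can_inj (mulKmx unitD).
rewrite /near_words -(card_imset [set X : 'M[K]_(m, k) | P #|col_supp (A - X *m G)|] mulD_inj).
have suppD X : col_supp (D *m A - D *m X *m G) = col_supp (A - X *m G).
  by rewrite -mulmxA -mulmxBr col_supp_unitmx.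
apply: eq_card => X; rewrite inE; apply/idP/imsetP => [PX | [Y /[!inE] PY ->]].
  by exists (invmx D *m X); rewrite ?mulKVmx // inE -suppD mulKVmx.
by rewrite suppD.
Qed.

(* A dual word h vanishing on S is orthogonal to every A - X G supported on S,
   hence to A itself. *)
Lemma near_words_far A w :
  (forall S : {set 'I_n}, (#|S| < w)%N -> exists h : 'rV_n,
     [/\ G *m h^T = 0, A *m h^T != 0 & [disjoint col_supp h & S]]) ->
  (near_words G A (fun d => d < w) == 0)%N.
Proof.
move=> far; rewrite cards_eq0; apply/eqP/setP => X; rewrite !inE.
apply/negP => /far[h [Gh /eqP Ah dj]]; apply: Ah.
rewrite -[A](subrK (X *m G)) mulmxDl -mulmxA Gh.
rewrite mulmx0 addr0; apply/colP => i; rewrite mxE [RHS]mxE big1 // => j _.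
have [hj | hj] := boolP (j \in col_supp h).
  have := disjointFr dj hj; rewrite inE => /negbFE/eqP/colP/(_ i).
  by rewrite [LHS]mxE => ->; rewrite mxE mul0r.
have hj0 : h 0 j = 0 by move: hj; rewrite inE negbK => /eqP/colP/(_ 0); rewrite !mxE.
by rewrite [h^T _ _]mxE hj0 mulr0.
Qed.

End NearWords.

(** * Ternary vectors as lists *)

(** A concrete three-element type on which the enumerations can be evaluated; [F3] carries the
    results to the prime field. *)
Inductive trit := T0 | T1 | T2.

Definition nat_of_trit t := match t with T0 => 0 | T1 => 1 | T2 => 2 end%N.
Definition trit_of_nat n := match n with 0 => T0 | 1 => T1 | _ => T2 end%N.
Lemma nat_of_tritK : cancel nat_of_trit trit_of_nat.
Proof. by case. Qed.
HB.instance Definition _ := Equality.copy trit (can_type nat_of_tritK).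

Definition F3 (t : trit) : 'F_3 := (nat_of_trit t)%:R.
Definition tneg t := match t with T0 => T0 | T1 => T2 | T2 => T1 end.
Definition tadd s t := match s, t with
  | T0, _ => t | _, T0 => s | T1, T1 => T2 | T2, T2 => T1 | _, _ => T0 end.
Definition tmul s t := match s, t with
  | T0, _ | _, T0 => T0 | T1, _ => t | T2, _ => tneg t end.
Definition tnz t := if t is T0 then false else true.

Lemma F3_0 : F3 T0 = 0. Proof. by []. Qed.
Lemma F3_1 : F3 T1 = 1. Proof. by []. Qed.
Lemma F3_2 : F3 T2 = -1. Proof. exact/eqP. Qed.
Lemma F3N t : F3 (tneg t) = - F3 t.
Proof. by case: t; apply/eqP. Qed.
Lemma F3D s t : F3 (tadd s t) = F3 s + F3 t.
Proof. by case: s; case: t; apply/eqP. Qed.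
Lemma F3M s t : F3 (tmul s t) = F3 s * F3 t.
Proof. by case: s; case: t; apply/eqP. Qed.
Lemma F3_eq0 t : (F3 t == 0) = ~~ tnz t.
Proof. by case: t. Qed.
Lemma trit_of_natK (x : 'F_3) : F3 (trit_of_nat x) = x.
Proof. by case: x => [[|[|[|//]]]] ?; apply: val_inj. Qed.
Lemma sum_F3 (f : 'F_3 -> nat) :
  (\sum_x f x = f (F3 T0) + f (F3 T1) + f (F3 T2))%N.
Proof.
rewrite 3!big_ord_recl big_ord0 addn0 addnA.
by congr (_ + _ + _)%N; congr f; apply: val_inj.
Qed.

(* Ternary vectors are lists padded with zeros to any length, so that no
   length condition is needed for sums. *)
Fixpoint vadd a b := match a, b with
  | [::], _ => b | _, [::] => a | x :: a', y :: b' => tadd x y :: vadd a' b' end.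
Definition vneg := map tneg.
Definition vsub a b := vadd a (vneg b).
Fixpoint dot a b := match a, b with
  | x :: a', y :: b' => tadd (tmul x y) (dot a' b') | _, _ => T0 end.
Definition supp := map tnz.
Fixpoint bor a b := match a, b with
  | [::], _ => b | _, [::] => a | x :: a', y :: b' => (x || y) :: bor a' b' end.

Definition vec n (l : seq trit) : 'rV['F_3]_n := \row_j F3 (nth T0 l j).
Definition mx k n (ls : seq (seq trit)) : 'M['F_3]_(k, n) :=
  \matrix_(i, j) F3 (nth T0 (nth [::] ls i) j).
Definition bset n (b : bitseq) : {set 'I_n} := [set i : 'I_n | nth false b i].

Lemma nth_vadd a b i : nth T0 (vadd a b) i = tadd (nth T0 a i) (nth T0 b i).
Proof.
elim: a b i => [|x a IHa] [|y b] [|i] //=; first by case: x.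
by case: (nth _ _ _).
Qed.

Lemma nth_vneg a i : nth T0 (vneg a) i = tneg (nth T0 a i).
Proof. by elim: a i => [|x a IHa] [|i] /=. Qed.

Lemma vecD n a b : vec n (vadd a b) = vec n a + vec n b.
Proof. by apply/rowP => i; rewrite !mxE nth_vadd F3D. Qed.

Lemma vecN n a : vec n (vneg a) = - vec n a.
Proof. by apply/rowP => i; rewrite !mxE nth_vneg F3N. Qed.

Lemma vecB n a b : vec n (vsub a b) = vec n a - vec n b.
Proof. by rewrite vecD vecN. Qed.

Lemma mx_cons k n a ls : mx k.+1 n (a :: ls) = col_mx (vec n a) (mx k n ls) :> 'M_(1 + k, n).
Proof.
apply/matrixP => i j; rewrite !mxE; case: splitP => i' eq_i; rewrite !mxE.
  by rewrite ord1 in eq_i; rewrite eq_i.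
by rewrite eq_i.
Qed.

Lemma nth_supp a i : nth false (supp a) i = tnz (nth T0 a i).
Proof. by elim: a i => [|x a IHa] [|i] /=. Qed.

Lemma col_supp_vec n a : col_supp (vec n a) = bset n (supp a).
Proof.
apply/setP => i; rewrite !inE nth_supp -[RHS]negbK -F3_eq0; congr (~~ _).
by apply/eqP/eqP => [/colP/(_ 0)|a0]; [|apply/colP => j]; rewrite !mxE.
Qed.

Lemma bset_bor n a b : bset n (bor a b) = bset n a :|: bset n b.
Proof.
apply/setP => i; rewrite !inE; elim: a b (i : nat) => [|x a IHa] [|y b] [|j] //=.
- by rewrite orbF.
- by rewrite orbF.
Qed.

Lemma card_bset n b : (size b <= n)%N -> #|bset n b| = count id b.
Proof.
move=> b_n; rewrite -sum1dep_card -(big_mkord (fun i => nth false b i) (fun=> 1%N)).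
rewrite sum1_count -(subnKC b_n) /index_iota subn0 iotaD count_cat.
rewrite [X in (_ + X)%N](@eq_in_count _ _ pred0) ?count_pred0 ?addn0.
  by rewrite -[X in _ = count id X](mkseq_nth false) count_map.
by move=> i; rewrite mem_iota => /andP[le_i _]; rewrite /= nth_default.
Qed.

(** The three branches are the coefficients 0, 1 and -1 of the first generator in a - u G. Started
    at the empty list, which stands for 0, it lists the code. *)
Fixpoint coset (Gl : seq (seq trit)) (a : seq trit) : seq (seq trit) :=
  if Gl is g :: Gl' then coset Gl' a ++ coset Gl' (vsub a g) ++ coset Gl' (vadd a g)
  else [:: a].

(** Pruning at w is safe for distances up to w, since a union of row supports is at least as large
    as each of them. *)
Definition supports w Gl a := [seq b <- map supp (coset Gl a) | count id b <= w]%N.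

(** One support is chosen per row: the column support of a matrix is the union of the supports of
    its rows. *)
Definition unions : seq (seq bitseq) -> seq bitseq :=
  foldr (fun s t => [seq bor b c | b <- s, c <- t]) [:: [::]].

Lemma big_col_mx (F : finFieldType) m r (f : 'M[F]_(1 + m, r) -> nat) :
  (\sum_X f X = \sum_x \sum_Y f (col_mx x Y)%R)%N.
Proof.
rewrite pair_big /= (reindex (fun p => col_mx p.1 p.2)) //=.
exists (fun X => (usubmx X, dsubmx X)) => [[x Y] _ | X _] /=.
  by rewrite col_mxKu col_mxKd.
exact: vsubmxK.
Qed.

Lemma big_row_mx (F : finFieldType) r (f : 'rV[F]_(1 + r) -> nat) :
  (\sum_u f u = \sum_c \sum_u f (row_mx c%:M u)%R)%N.
Proof.
rewrite pair_big /= (reindex (fun p => row_mx p.1%:M p.2)) //=.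
exists (fun u => (lsubmx u 0 0, rsubmx u)) => [[c u] _ | u _] /=.
  by rewrite row_mxKl row_mxKr mxE.
by rewrite -mx11_scalar hsubmxK.
Qed.

(** Splitting off the first coefficient yields the branches of [coset]. With an arbitrary summand,
    this one bridge serves for counts and for universal statements. *)
Lemma sum_coset n k Gl a (f : 'rV['F_3]_n -> nat) : size Gl = k ->
  (\sum_(u : 'rV_k) f (vec n a - u *m mx k n Gl)%R = \sum_(l <- coset Gl a) f (vec n l))%N.
Proof.
move=> <-{k}; elim: Gl a => [|g Gs IHG] a /=.
  rewrite big_seq1 (eq_bigr (fun=> f (vec n a))) => [|u _].
    by rewrite sum_nat_const card_mx expn0 mul1n.
  by rewrite [u]thinmx0 mul0mx subr0.
rewrite !big_cat -!IHG /= addnA.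
rewrite (big_row_mx (fun u => f (vec n a - u *m mx (size Gs).+1 n (g :: Gs)))).
have eq_c t : (\sum_(u : 'rV_(size Gs))
      f (vec n a - row_mx (F3 t)%:M u *m mx (size Gs).+1 n (g :: Gs))%R
   = \sum_(u : 'rV_(size Gs)) f (vec n a - F3 t *: vec n g - u *m mx (size Gs) n Gs)%R)%N.
  apply: eq_bigr => u _; congr f.
  by rewrite (mx_cons (size Gs) n g Gs) mul_row_col mul_scalar_mx opprD addrA.
rewrite [LHS]sum_F3; congr (_ + _ + _)%N; rewrite eq_c.
- by rewrite F3_0 scale0r subr0.
- by rewrite F3_1 vecB scale1r.
- by rewrite F3_2 vecD scaleN1r opprK.
Qed.

Lemma size_bor a b : size (bor a b) = maxn (size a) (size b).
Proof. by elim: a b => [|x a IHa] [|y b] //=; rewrite IHa maxnSS. Qed.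

Lemma size_vadd a b : size (vadd a b) = maxn (size a) (size b).
Proof. by elim: a b => [|x a IHa] [|y b] //=; rewrite IHa maxnSS. Qed.

Lemma size_coset n Gl a l : (size a <= n)%N -> all (fun g => size g <= n)%N Gl ->
  l \in map supp (coset Gl a) -> (size l <= n)%N.
Proof.
move=> a_n; elim: Gl a a_n => [|g Gs IHG] a a_n /=.
  by move=> _; rewrite inE => /eqP ->; rewrite size_map.
case/andP=> g_n Gs_n; rewrite !map_cat !mem_cat => /or3P[]; apply: IHG => //.
  by rewrite size_vadd geq_max a_n size_map.
by rewrite size_vadd geq_max a_n.
Qed.

Section ListEnumeration.
Variables (n k w : nat) (Gl : seq (seq trit)).
Hypotheses (sizeG : size Gl = k) (shortG : all (fun g => size g <= n)%N Gl).

Definition all_supports (A : seq (seq trit)) := unions [seq supports w Gl a | a <- A].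

Lemma size_all_supports A b : all (fun a => size a <= n)%N A ->
  b \in all_supports A -> (size b <= n)%N.
Proof.
rewrite /all_supports; elim: A b => [|a A IHA] b /=; first by rewrite inE => _ /eqP ->.
case/andP=> a_n A_n /allpairsP[[c d] /= [c_a d_A ->]].
rewrite size_bor geq_max (IHA d) // andbT.
by move: c_a; rewrite mem_filter => /andP[_]; apply: size_coset.
Qed.

(** Induction on the rows; a row pruned away contributes 0 because f vanishes on sets of more than w
    elements. *)
Lemma sum_all_supports A (f : {set 'I_n} -> nat) :
  all (fun a => size a <= n)%N A -> (forall S : {set 'I_n}, (w < #|S|)%N -> f S = 0%N) ->
  (\sum_(X : 'M_(size A, k)) f (col_supp (mx (size A) n A - X *m mx k n Gl)%R) =
   \sum_(b <- all_supports A) f (bset n b))%N.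
Proof.
rewrite /all_supports; elim: A f => [|a A IHA] f /=.
  move=> _ f0; rewrite big_seq1 (eq_bigr (fun=> f (bset n [::]))) => [|X _].
    by rewrite sum_nat_const card_mx expn0 mul1n.
  congr f; rewrite [_ - _]flatmx0 col_supp0; apply/setP => i.
  by rewrite !inE nth_nil.
case/andP=> a_n A_n f0.
rewrite (big_col_mx (fun X => f (col_supp (mx (size A).+1 n (a :: A) - X *m mx k n Gl)))).
rewrite big_allpairs_dep /supports big_filter.
rewrite (eq_bigr (fun x : 'rV_k => \sum_Y f (col_supp (vec n a - x *m mx k n Gl)%R
   :|: col_supp (mx (size A) n A - Y *m mx k n Gl)%R))%N) => [|x _]; last first.
  apply: eq_bigr => Y _; rewrite -col_supp_col_mx -add_col_mx -opp_col_mx -mul_col_mx.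
  by rewrite -(mx_cons (size A) n a A).
(* The sum over the remaining rows, as a function of the support S of the first; it inherits the
   vanishing above w. *)
pose h (S : {set 'I_n}) := (\sum_Y f (S :|: col_supp (mx (size A) n A - Y *m mx k n Gl)%R))%N.
have h0 (S : {set 'I_n}) : (w < #|S|)%N -> h S = 0%N.
  move=> wS; rewrite /h big1 // => Y _; apply: f0; apply: leq_trans wS _.
  exact/subset_leq_card/subsetUl.
rewrite (sum_coset a (fun v => h (col_supp v)) sizeG).
under eq_bigr do rewrite col_supp_vec.
rewrite -(big_map supp xpredT (fun b => h (bset n b))) big_mkcond.
rewrite [RHS]big_mkcond big_seq [RHS]big_seq; apply: eq_bigr => b b_a /=.
rewrite -(card_bset (size_coset a_n shortG b_a)).
have [le_w | lt_w] := leqP; last by rewrite h0.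
have f'0 (S : {set 'I_n}) : (w < #|S|)%N -> f (bset n b :|: S) = 0%N.
  by move=> wS; apply: f0; apply: leq_trans wS _; exact/subset_leq_card/subsetUr.
rewrite /h (IHA (fun S => f (bset n b :|: S)) A_n f'0).
by apply: eq_bigr => c _; rewrite bset_bor.
Qed.

Lemma near_words_list A (P : pred nat) :
  all (fun a => size a <= n)%N A -> (forall d, P d -> d <= w)%N ->
  near_words (mx k n Gl) (mx (size A) n A) P = count (preim (count id) P) (all_supports A).
Proof.
move=> A_n Pw; rewrite /near_words -sum1dep_card big_mkcond /=.
rewrite (sum_all_supports (f := fun S => if P #|S| then 1 else 0)%N) // => [|S].
  rewrite -big_mkcond sum1_count; apply: eq_in_count => b b_A /=.
  by rewrite card_bset // (size_all_supports A_n).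
by rewrite ltnNge; case: ifP => // /Pw ->.
Qed.

End ListEnumeration.

(** * Certificates for a presented code *)

Fixpoint all_bits n : seq bitseq :=
  if n is n'.+1 then map (cons true) (all_bits n') ++ map (cons false) (all_bits n')
  else [:: [::]].

Lemma mem_all_bits n b : (b \in all_bits n) = (size b == n).
Proof.
have cons_inj (x : bool) : injective (cons x) by move=> ? ? [].
elim: n b => [|n IHn] [|x b] //=.
  by rewrite mem_cat; apply/negbTE/norP; split; apply/mapP => -[].
rewrite eqSS -IHn mem_cat; case: x.
  rewrite mem_map //; case: (b \in _) => //=; apply/mapP => -[//].
by rewrite orbC mem_map //; case: (b \in _) => //=; apply/mapP => -[//].
Qed.

Lemma uniq_all_bits n : uniq (all_bits n).
Proof.
have cons_inj (x : bool) : injective (cons x) by move=> ? ? [].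
elim: n => //= n IHn; rewrite cat_uniq !map_inj_uniq // IHn andbT /=.
by apply/hasPn => _ /mapP[b _ ->]; apply/mapP => -[].
Qed.

Lemma bset_onto n (S : {set 'I_n}) : exists2 b, b \in all_bits n & S = bset n b.
Proof.
exists [seq i \in S | i <- enum 'I_n].
  by rewrite mem_all_bits size_map size_enum_ord.
by apply/setP => i; rewrite inE (nth_map i) ?size_enum_ord // nth_ord_enum.
Qed.

Lemma bset_inj n : {in all_bits n &, injective (bset n)}.
Proof.
move=> b c; rewrite !mem_all_bits => /eqP sb /eqP sc /setP eq_bc.
apply: (@eq_from_nth _ false) => [|i]; rewrite ?sb ?sc // => i_n.
by have := eq_bc (Ordinal i_n); rewrite !inE.
Qed.

Lemma card_set_list n (P : pred {set 'I_n}) :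
  #|[set S | P S]| = count (preim (bset n) P) (all_bits n).
Proof.
rewrite -count_map -size_filter -(card_uniqP _); last first.
  by rewrite filter_uniq // (map_inj_in_uniq (@bset_inj n)) uniq_all_bits.
apply: eq_card => S; rewrite inE mem_filter; case: (bset_onto S) => b b_n ->.
by rewrite map_f // andbT.
Qed.

(** Truncation by [zip] is harmless: entries beyond the end of a list count as false. *)
Definition disj (a b : bitseq) := all (fun p => ~~ (p.1 && p.2)) (zip a b).

Lemma disj_bset n a b : (size a <= n)%N -> disj a b = [disjoint bset n a & bset n b].
Proof.
move=> a_n; rewrite /disj; apply/idP/pred0P => [ab i | ab0].
  rewrite /= !inE; apply/negbTE; move: (nat_of_ord i) ab => {a_n}{}i.
  elim: a b i => [|x a IHa] [|y b] [|i] //=; rewrite ?andbF //.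
    by case/andP.
  by case/andP=> _; apply: IHa.
have {a_n}ab0 i : ~~ (nth false a i && nth false b i).
  have [i_n | n_i] := ltnP i n; first by have /= := ab0 (Ordinal i_n); rewrite !inE => ->.
  by rewrite nth_default // (leq_trans a_n).
elim: a b ab0 => [|x a IHa] [|y b] //= ab0.
by rewrite (ab0 0%N) IHa // => i; apply: (ab0 i.+1).
Qed.

Lemma sum_dot n g h : (size g <= n)%N ->
  \sum_(j < n) F3 (nth T0 g j) * F3 (nth T0 h j) = F3 (dot g h).
Proof.
elim: n g h => [|n IHn] [|x g] h //= g_n.
- by rewrite big_ord0 F3_0.
- by rewrite F3_0 big1 // => j _; rewrite nth_nil F3_0 mul0r.
case: h => [|y h]; first by rewrite F3_0 big1 // => j _; rewrite nth_nil F3_0 mulr0.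
by rewrite big_ord_recl /= (IHn g h g_n) -F3M -F3D.
Qed.

Lemma mx_mul_trmx_vec k n A h : all (fun g => size g <= n)%N A ->
  mx k n A *m (vec n h)^T = \col_(i < k) F3 (dot (nth [::] A i) h).
Proof.
move=> A_n; apply/colP => i; rewrite !mxE.
rewrite -(@sum_dot n); last first.
  by have [iA | Ai] := ltnP i (size A);
    [exact: (allP A_n) _ (mem_nth _ iA) | rewrite nth_default].
by apply: eq_bigr => j _; rewrite !mxE.
Qed.

(** The number of failures is zero on the list, hence zero over all coefficient rows. *)
Lemma coset_all n k Tl a (P : pred 'rV['F_3]_n) : size Tl = k ->
  all (fun l => P (vec n l)) (coset Tl a) ->
  forall y : 'rV_k, P (vec n a - y *m mx k n Tl).
Proof.
move=> sizeT /allP P_all y.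
have: (\sum_(l <- coset Tl a) ~~ P (vec n l) = 0)%N.
  by rewrite big_seq big1 // => l l_a; rewrite P_all.
rewrite -(sum_coset a (fun v => ~~ P v : nat) sizeT) => /eqP.
by rewrite sum_nat_eq0 => /forallP/(_ y) /=; rewrite eqb0 negbK.
Qed.

Lemma vec_nil n : vec n [::] = 0.
Proof. by apply/rowP => i; rewrite !mxE nth_nil F3_0. Qed.

Lemma col_supp_mx n k A : size A = k ->
  col_supp (mx k n A) = bset n (foldr bor [::] (map supp A)).
Proof.
move=> <-; elim: A => [|a A IHA] /=.
  by rewrite [mx 0 n [::]]flatmx0 col_supp0; apply/setP => i; rewrite !inE nth_nil.
by rewrite bset_bor -IHA -col_supp_vec -col_supp_col_mx -mx_cons.
Qed.

(* G generates C and T spans a complement of it supported on r coordinates. *)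
Record presentation n k r (C : {vspace 'rV['F_3]_n}) (Gl Tl : seq (seq trit)) : Prop :=
  Presentation {
    presentation_mem : forall x, x \in C <-> exists u : 'rV_k, x = u *m mx k n Gl;
    presentation_gen : forall m (A : 'M_(m, n)), exists U, exists Y,
      A = U *m mx k n Gl + Y *m mx r n Tl }.

(** The last condition bounds the joint support of the complement; it yields the redundancy bound on
    the covering radius. *)
Definition valid_lists (n k r : nat) (Gl Tl : seq (seq trit)) :=
  [&& size Gl == k, size Tl == r, all (fun g => size g <= n) Gl,
      all (fun g => size g <= n) Tl & count id (foldr bor [::] (map supp Tl)) <= r]%N.

(** Weight 0 occurring only once certifies that the generators are independent. *)
Definition weights_check Gl d :=
  let ws := [seq count id b | b <- map supp (coset Gl [::])] in
  [&& all (fun w => (w == 0) || (d <= w)) ws, d \in ws, d != 0 & count (pred1 0) ws == 1]%N.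

(** A certificate for [near_words_far], with the dual words h drawn from the span of [Hl]. *)
Definition far_check n w Gl Hl Al :=
  let D := [seq supp h | h <- coset Hl [::] &
              all (fun g => dot g h == T0) Gl && has (fun a => dot a h != T0) Al] in
  all (fun b => (count id b < w)%N ==> has (fun s => disj s b) D) (all_bits n).

(** The condition that the APMCF property imposes at a single point; points nearer than R are exempt
    from the count. *)
Definition apmcf_counts (R lambda : nat) (ss : seq bitseq) :=
  (has (fun b => count id b <= R) ss &&
   (has (fun b => count id b < R) ss || (count (fun b => count id b == R) ss == lambda)))%N.

Section Code.
Variables (n k r : nat) (C : {vspace 'rV['F_3]_n}) (Gl Tl : seq (seq trit)).
Hypothesis presC : presentation k r C Gl Tl.
Hypothesis validC : valid_lists n k r Gl Tl.
Let G := mx k n Gl.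
Let T := mx r n Tl.

Let sizeG : size Gl = k. Proof. by case/and5P: validC => /eqP. Qed.
Let sizeT : size Tl = r. Proof. by case/and5P: validC => _ /eqP. Qed.
Let shortG : all (fun g => size g <= n)%N Gl. Proof. by case/and5P: validC. Qed.
Let shortT : all (fun g => size g <= n)%N Tl. Proof. by case/and5P: validC. Qed.

Lemma size_supp_coset Ll l : all (fun g => size g <= n)%N Ll ->
  l \in coset Ll [::] -> (size l <= n)%N.
Proof.
move=> shortL l_L; rewrite -(size_map tnz).
exact: (@size_coset n Ll [::] _ (leq0n n) shortL (map_f supp l_L)).
Qed.

(** Subtracting a codeword leaves a combination of the rows of T, which lives on at most r
    coordinates. *)
Lemma near_words_redundancy m (A : 'M_(m, n)) : (0 < near_words G A (fun d => d <= r))%N.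
Proof.
have [U [Y ->]] := presentation_gen presC A; rewrite addrC near_words_add.
rewrite card_gt0; apply/set0Pn; exists 0; rewrite inE mul0mx subr0.
apply: leq_trans (subset_leq_card (col_supp_mulmx _ _)) _.
case/and5P: validC => _ _ _ _; apply: leq_trans.
rewrite /T col_supp_mx // card_bset //.
elim: (Tl) shortT => //= t Ts IHT /andP[t_n Ts_n].
by rewrite size_bor geq_max size_map t_n IHT.
Qed.

Lemma far_checkP w Hl Al :
  all (fun h => size h <= n)%N Hl -> all (fun a => size a <= n)%N Al ->
  far_check n w Gl Hl Al ->
  (near_words G (mx (size Al) n Al) (fun d => d < w) == 0)%N.
Proof.
move=> shortH shortA /allP far; apply: near_words_far => S S_w.
have [b b_n eqS] := bset_onto S.
have sb : size b = n by apply/eqP; rewrite -mem_all_bits.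
have := far b b_n; rewrite -(card_bset (n := n)) ?sb // -eqS S_w /=.
case/hasP => s /mapP[h] /[!mem_filter] /andP[/andP[Gh Ah] h_H] -> disj_hb.
have h_n := size_supp_coset shortH h_H.
exists (vec n h); rewrite !mx_mul_trmx_vec //; split.
- apply/colP => i; rewrite !mxE; have /allP/(_ (nth [::] Gl i)) := Gh.
  by rewrite mem_nth ?sizeG // => /(_ isT)/eqP ->; rewrite F3_0.
- case/hasP: Ah => a /(nthP [::])[i i_A <-] ah.
  apply/eqP => /colP/(_ (Ordinal i_A)); rewrite !mxE => /eqP.
  by rewrite F3_eq0; case: (dot _ _) ah.
by rewrite col_supp_vec eqS -disj_bset // size_map.
Qed.

Variable d : nat.
Hypothesis weightsG : weights_check Gl d.

Let count_words (P : pred nat) :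
  #|[set u : 'rV_k | P #|col_supp (u *m G)|]| =
  count (preim (count id) P) (map supp (coset Gl [::])).
Proof.
have := sum_coset [::] (fun v : 'rV['F_3]_n => P #|col_supp v| : nat) sizeG.
rewrite vec_nil => sumG; rewrite -sum1dep_card big_mkcond /=.
transitivity (\sum_(u : 'rV_k) P #|col_supp (0 - u *m G)%R|)%N.
  by apply: eq_bigr => u _; rewrite sub0r col_supp_opp; case: (P _).
rewrite sumG count_map -sum1_count [RHS]big_mkcond !big_seq; apply: eq_bigr => l l_G /=.
by rewrite col_supp_vec card_bset ?size_map ?(size_supp_coset shortG).
Qed.

(** Exactly one coefficient row gives weight 0, and both 0 and u do. *)
Lemma generator_inj (u : 'rV_k) : u *m G = 0 -> u = 0.
Proof.
move=> uG; case/and4P: weightsG => _ _ _; rewrite count_map.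
rewrite (eq_count (a2 := preim (count id) (pred1 0%N))) // -count_words.
case/cards1P => v /setP eq_v; have := eq_v 0; have := eq_v u.
by rewrite !inE uG mul0mx col_supp0 cards0 eqxx => /esym/eqP -> /esym/eqP ->.
Qed.

Lemma generator_weights (u : 'rV_k) : u != 0 -> (d <= #|col_supp (u *m G)|)%N.
Proof.
move=> u0; case/and4P: weightsG => /allP all_w _ _ _.
rewrite leqNgt; apply/negP => u_d.
have: (0 < #|[set u : 'rV_k | (fun w => (w != 0) && (w < d)) #|col_supp (u *m G)|]|)%N.
  rewrite card_gt0; apply/set0Pn; exists u; rewrite inE u_d andbT cards_eq0 col_supp_eq0.
  by apply: contra u0 => /eqP/generator_inj ->.
rewrite (count_words (fun w => (w != 0%N) && (w < d)%N)) -has_count.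
case/hasP => b b_G /andP[b0 b_d].
by have := all_w _ (map_f (count id) b_G); rewrite (negPf b0) leqNgt b_d.
Qed.

Lemma generator_min_weight : exists2 u : 'rV_k, u != 0 & #|col_supp (u *m G)| == d.
Proof.
case/and4P: weightsG => _ d_G d0 _.
have: (0 < #|[set u : 'rV_k | pred1 d #|col_supp (u *m G)|]|)%N.
  rewrite (count_words (pred1 d)) -has_count; case/mapP: d_G => b b_G ->.
  by apply/hasP; exists b => /=.
rewrite card_gt0 => /set0Pn[u /[!inE] /eqP ud]; exists u; last exact/eqP.
apply: contra d0 => /eqP u0; move: ud; rewrite u0 mul0mx col_supp0 cards0 => <- //.
Qed.

(** The number of information sets of the ternary code, in the form given by [info_set_lifted].
    Neither m nor the extension field occurs, so one value serves as lambda for all large m. *)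
Definition num_info_mx : nat :=
  #|[set J : {set 'I_n} | (#|J| == k) &&
      (#|[set u : 'rV_k | [disjoint col_supp (u *m G) & J]]| == 1)]|%N.

Definition num_info_list (m : nat) : nat :=
  let S := map supp (coset Gl [::]) in
  count (fun b => (count id b == m) && (count (fun s => disj s b) S == 1))%N (all_bits n).

Lemma num_info_mxE : num_info_mx = num_info_list k.
Proof.
rewrite /num_info_mx /num_info_list card_set_list; apply: eq_in_count => b b_n /=.
have sb : size b = n by apply/eqP; rewrite -mem_all_bits.
rewrite card_bset ?sb //; congr (_ && (_ == _)).
have := sum_coset [::] (fun v : 'rV['F_3]_n => [disjoint col_supp v & bset n b] : nat) sizeG.
rewrite vec_nil => sumG; rewrite -sum1dep_card big_mkcond /=.
transitivity (\sum_(u : 'rV_k) [disjoint col_supp (0 - u *m G)%R & bset n b])%N.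
  by apply: eq_bigr => u _; rewrite sub0r col_supp_opp; case: ([disjoint _ & _]).
rewrite sumG count_map -sum1_count [RHS]big_mkcond !big_seq; apply: eq_bigr => l l_G /=.
by rewrite col_supp_vec -disj_bset ?size_map ?(size_supp_coset shortG).
Qed.

End Code.

(** Additional rows can only enlarge supports, so a far point for one m gives one for every larger
    m. *)
Lemma near_words_pad (K : finFieldType) m s n k (G : 'M[K]_(k, n)) (A : 'M_(m, n)) w :
  (near_words G A (fun d => d < w) == 0)%N ->
  (near_words G (col_mx A (0 : 'M_(s, n))) (fun d => d < w) == 0)%N.
Proof.
rewrite !cards_eq0 => /eqP/setP farA; apply/eqP/setP => X; rewrite !inE.
have := farA (usubmx X); rewrite !inE => /negbT; rewrite -leqNgt => le_w.
apply/negbTE; rewrite -leqNgt; apply: leq_trans le_w (subset_leq_card _).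
rewrite -{2}[X]vsubmxK mul_col_mx opp_col_mx add_col_mx col_supp_col_mx.
exact: subsetUl.
Qed.

(** Lets the ternary codes be treated as their own lifts with m = 1. *)
Lemma lifted_id (K : finFieldType) n (C : {vspace 'rV[K]_n}) : lifted idfun C = C.
Proof.
rewrite -[RHS]null_code_parity_check_mx /lifted; congr null_code.
by apply/matrixP => i j; rewrite mxE.
Qed.

Definition apmcf_at (K : finFieldType) m n k (G : 'M[K]_(k, n)) (R lambda : nat)
    (A : 'M_(m, n)) :=
  ((0 < near_words G A (fun d => d <= R)) &&
   ((0 < near_words G A (fun d => d < R)) || (near_words G A (pred1 R) == lambda)))%N.

(* A combination, with coefficients c > 0 at P and -c at N, of the equations
   that UPWS imposes at the vectors with rows A: it eliminates every unknown
   but not the right-hand side. *)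
Definition weight_sum R Gl j (Q : seq (nat * seq (seq trit))) : nat :=
  sumn [seq (q.1 * count (fun b => count id b == j) (all_supports R Gl q.2))%N | q <- Q].

Definition upws_check n m R Gl (P N : seq (nat * seq (seq trit))) :=
  [&& all (fun q => (size q.2 == m) && all (fun a => size a <= n)%N q.2) (P ++ N),
      all (fun j => weight_sum R Gl j P == weight_sum R Gl j N) (iota 0 R.+1) &
      sumn (map fst P) != sumn (map fst N)].

(** * From list certificates to parameters of lifted codes *)

Section LiftedPresentation.
Variables (n k r d : nat) (C : {vspace 'rV['F_3]_n}) (Gl Tl : seq (seq trit)).
Hypothesis presC : presentation k r C Gl Tl.
Hypothesis validC : valid_lists n k r Gl Tl.
Hypothesis weightsG : weights_check Gl d.
Let G := mx k n Gl.

Let sizeG : size Gl = k. Proof. by case/and5P: validC => /eqP. Qed.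
Let sizeT : size Tl = r. Proof. by case/and5P: validC => _ /eqP. Qed.
Let shortG : all (fun g => size g <= n)%N Gl. Proof. by case/and5P: validC. Qed.
Let shortT : all (fun g => size g <= n)%N Tl. Proof. by case/and5P: validC. Qed.
Let memC x := equivP idP (presentation_mem presC x).
Let G_inj := generator_inj validC weightsG.

Lemma apmcf_at_list R lambda A : all (fun a => size a <= n)%N A ->
  apmcf_at G R lambda (mx (size A) n A) = apmcf_counts R lambda (all_supports R Gl A).
Proof.
move=> shortA; rewrite /apmcf_at !(near_words_list (w := R) sizeG shortG shortA) //.
- by rewrite -!has_count.
- by move=> e /eqP ->.
- by move=> e /ltnW.
Qed.

Lemma far_list R A : all (fun a => size a <= n)%N A ->
  ~~ has (fun b => count id b < R)%N (all_supports R Gl A) ->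
  (near_words G (mx (size A) n A) (fun e => e < R) == 0)%N.
Proof.
move=> shortA far; rewrite (near_words_list (w := R) sizeG shortG shortA) => [|e /ltnW //].
by rewrite -leqn0 leqNgt -has_count.
Qed.

Variables (L : finFieldType) (iota : {rmorphism 'F_3 -> L}) (m : nat).
Hypotheses (m_gt0 : (0 < m)%N) (cardL : #|L| = (3 ^ m)%N).

Let cardLK : #|L| = (#|'F_3| ^ m)%N. Proof. by rewrite card_Fp. Qed.

Lemma lifted_params R lambda :
  (forall A : 'M_(m, n), apmcf_at G R lambda A) ->
  (exists A : 'M_(m, n), near_words G A (fun e => e < R) == 0)%N ->
  code_params (lifted iota C) k d R /\ APMCF (lifted iota C) R lambda.
Proof.
move=> good far; have [alpha alpha_inj] := ex_lift_basis iota cardLK.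
have leR (A : 'M_(m, n)) : (0 < near_words G A (fun e => e <= R))%N by case/andP: (good A).
split; last first.
  apply: (APMCF_lifted alpha_inj cardLK memC G_inj leR far) => A farA.
  by have /andP[_] := good A; rewrite (eqP farA) => /eqP.
split; first exact: (dim_lifted alpha_inj cardLK memC G_inj).
  apply: (min_dist_lifted alpha_inj cardLK memC G_inj m_gt0) => [u|].
    exact: (generator_weights validC weightsG).
  exact: (generator_min_weight validC weightsG).
exact: (covering_radius_lifted alpha_inj cardLK memC leR far).
Qed.

(** The complement bounds the radius by r, the padded rows [Al] attain r, and [B_redundancy]
    identifies lambda with the number of information sets. *)
Lemma lifted_params_redundancy Hl Al : n = (k + r)%N ->
  all (fun h => size h <= n)%N Hl -> all (fun a => size a <= n)%N Al ->
  far_check n r Gl Hl Al -> (size Al <= m)%N ->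
  code_params (lifted iota C) k d r /\
  APMCF (lifted iota C) r (num_info_mx n k Gl).
Proof.
move=> n_kr shortH shortA far Al_m.
have [alpha alpha_inj] := ex_lift_basis iota cardLK.
have farA : exists A : 'M_(m, n), (near_words G A (fun e => e < r) == 0)%N.
  rewrite -(subnKC Al_m); exists (col_mx (mx (size Al) n Al) 0).
  exact/near_words_pad/(far_checkP validC shortH shortA far).
have leR (A : 'M_(m, n)) := near_words_redundancy presC validC A.
have dimC : \dim (lifted iota C) = k := dim_lifted alpha_inj cardLK memC G_inj m_gt0.
have covC : covering_radius (lifted iota C) = r.
  exact: (covering_radius_lifted alpha_inj cardLK memC leR farA).
split.
  split=> //; apply: (min_dist_lifted alpha_inj cardLK memC G_inj m_gt0) => [u|].
    exact: (generator_weights validC weightsG).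
  exact: (generator_min_weight validC weightsG).
split=> // v dist_v; have nk : (n - \dim (lifted iota C))%N = r by rewrite dimC n_kr addKn.
rewrite -{1}nk B_redundancy ?nk // /num_info_sets dimC.
apply: eq_card => J; rewrite !inE.
by rewrite (info_set_lifted alpha_inj cardLK memC G_inj J m_gt0).
Qed.

Lemma not_UPWS_list R P N : upws_check n m R Gl P N ->
  covering_radius (lifted iota C) = R -> ~ UPWS (lifted iota C).
Proof.
case/and3P=> validPN eqPN neqPN covR; rewrite /UPWS covR => -[beta upws].
have [alpha alpha_inj] := ex_lift_basis iota cardLK.
pose cnt (j : nat) A := count (fun b => count id b == j) (all_supports R Gl A).
have cntE j A : (j <= R)%N -> size A = m -> all (fun a => size a <= n)%N A ->
    near_words G (mx m n A) (pred1 j) = cnt j A.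
  move=> j_R <- shortA.
  by rewrite (near_words_list (w := R) sizeG shortG shortA) // => e /eqP ->.
have weightA A : size A = m -> all (fun a => size a <= n)%N A ->
    \sum_(j < R.+1) beta j * (cnt j A)%:R = 1.
  move=> sizeA shortA; rewrite -[RHS](upws (lift iota alpha (mx m n A))).
  by apply: eq_bigr => j _; rewrite (B_lift alpha_inj cardLK memC G_inj) cntE // -ltnS.
(* Under UPWS a weighted list of points evaluates to the sum of its multipliers. P and N have equal
   weight sums at every distance up to R, so their multipliers would have equal sums. *)
have eqnE Q : all (fun q => (size q.2 == m) && all (fun a => size a <= n)%N q.2) Q ->
    \sum_(j < R.+1) beta j * (weight_sum R Gl j Q)%:R = (sumn (map fst Q))%:R.
  elim: Q => [_|[c A] Q IHQ /= /andP[/andP[/eqP sizeA shortA] validQ]].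
    by rewrite big1 // => j _; rewrite mulr0.
  rewrite natrD -IHQ // -[c%:R]mulr1 -[X in _ * X](weightA A sizeA shortA).
  rewrite mulr_sumr -big_split; apply: eq_bigr => j _ /=.
  have -> : weight_sum R Gl j ((c, A) :: Q) = (c * cnt j A + weight_sum R Gl j Q)%N by [].
  by rewrite natrD natrM mulrDr mulrCA.
move: validPN; rewrite all_cat => /andP[validP validN].
case/negP: neqPN; rewrite -(eqr_nat rat) -!eqnE //.
apply/eqP/eq_bigr => j _; congr (_ * _%:R); apply/eqP/(allP eqPN).
by rewrite mem_iota /= add0n ltn_ord.
Qed.

End LiftedPresentation.

(** * Row reduction of pairs *)

Fixpoint all_trits n : seq (seq trit) :=
  if n is n'.+1 then [seq t :: l | t <- [:: T0; T1; T2], l <- all_trits n'] else [:: [::]].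

Lemma mem_all_trits n l : (l \in all_trits n) = (size l == n).
Proof.
elim: n l => [|n IHn] [|t l] //; first by apply/negbTE/allpairsP => -[[s u] []].
rewrite eqSS -IHn; apply/allpairsP/idP => [[[s u] /= [_ u_n [_ ->]]] // | l_n].
by exists (t, l); split=> //; case: t.
Qed.

Lemma vec_onto n (v : 'rV['F_3]_n) : exists2 l, size l = n & v = vec n l.
Proof.
exists [seq trit_of_nat (v 0 i) | i <- enum 'I_n]; first by rewrite size_map size_enum_ord.
by apply/rowP => i; rewrite mxE (nth_map i) ?size_enum_ord // nth_ord_enum trit_of_natK.
Qed.

(** The leading entry is 1; the zero row counts as normal. *)
Fixpoint normal (a : seq trit) :=
  match a with T0 :: a' => normal a' | T2 :: _ => false | _ => true end.

(* The entry of b in the column of the leading entry of a. *)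
Fixpoint pivot (a b : seq trit) :=
  match a, b with T0 :: a', _ :: b' => pivot a' b' | _ :: _, y :: _ => y | _, _ => T0 end.

(** Pairs of lower rank are included: a zero second row is normal and puts no condition on the
    first. *)
Fixpoint rref n : seq (seq trit * seq trit) :=
  if n is n'.+1 then
    [seq (T0 :: p.1, T0 :: p.2) | p <- rref n'] ++
    [seq (T1 :: a, T0 :: b) | b <- [seq b <- all_trits n' | normal b],
                              a <- [seq a <- all_trits n' | pivot b a == T0]]
  else [:: ([::], [::])].

Lemma normal_or_neg a : normal a || normal (vneg a).
Proof. by elim: a => [|[] a IHa]. Qed.

(** The leading entry of b is 1, so adding b up to twice takes the pivot entry of a through all
    three values. *)
Lemma pivot_elim a b : normal b -> size a = size b ->
  [\/ pivot b a = T0, pivot b (vadd a b) = T0 | pivot b (vadd (vadd a b) b) = T0].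
Proof.
elim: b a => [|[] b IHb] [|x a] //=; first by constructor.
  by move=> nb [sab]; exact: IHb.
by move=> _ _; case: x; [constructor 1 | constructor 3 | constructor 2].
Qed.

(** Gaussian elimination as an induction principle: swap, negation and addition of one row to the
    other reduce every pair to echelon form. *)
Lemma rref_ind n (Q : seq trit -> seq trit -> Prop) :
  (forall a b, Q b a -> Q a b) -> (forall a b, Q (vneg a) b -> Q a b) ->
  (forall a b, Q a (vadd b a) -> Q a b) ->
  (forall p, p \in rref n -> Q p.1 p.2) ->
  forall a b, size a = n -> size b = n -> Q a b.
Proof.
elim: n Q => [|n IHn] Q swapQ negQ addQ rrefQ.
  by move=> a b /size0nil -> /size0nil ->; exact: (rrefQ ([::], [::])).
have swap_negQ a b : Q a (vneg b) -> Q a b by move/swapQ/negQ/swapQ.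
have swap_addQ a b : Q (vadd a b) b -> Q a b by move/swapQ/addQ/swapQ.
(* The restrictions are lifted one by one: first b normal, then any b, then any first entry of the
   second row, then any nonzero first entry of the first row. *)
have Q10n a b : size a = n -> size b = n -> normal b -> Q (T1 :: a) (T0 :: b).
  move=> sa sb nb.
  have Qpivot c : size c = n -> pivot b c = T0 -> Q (T1 :: c) (T0 :: b).
    move=> sc pc; apply: (rrefQ (T1 :: c, T0 :: b)); rewrite mem_cat; apply/orP; right.
    by apply/allpairsPdep; exists b, c; rewrite !mem_filter !mem_all_trits sb sc nb pc !eqxx.
  have [||] := pivot_elim nb (etrans sa (esym sb)); first exact: Qpivot.
    by move=> pab; apply: swap_addQ; apply: Qpivot; rewrite // size_vadd sa sb maxnn.
  move=> pab; do 2!apply: (swap_addQ); apply: Qpivot => //.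
  by rewrite !size_vadd sa sb !maxnn.
have Q10 a b : size a = n -> size b = n -> Q (T1 :: a) (T0 :: b).
  move=> sa sb; case/orP: (normal_or_neg b) => nb; first exact: Q10n.
  by apply: swap_negQ; apply: Q10n; rewrite ?size_map.
have Q1 a y b : size a = n -> size b = n -> Q (T1 :: a) (y :: b).
  move=> sa sb; case: y; first exact: Q10.
    by do 2!apply: (addQ); apply: Q10; rewrite ?size_vadd ?sa ?sb ?maxnn.
  by apply: addQ; apply: Q10; rewrite ?size_vadd ?sa ?sb ?maxnn.
have Qnz x a y b : size a = n -> size b = n -> x != T0 -> Q (x :: a) (y :: b).
  by move=> sa sb; case: x => // _; [|apply: negQ]; apply: Q1; rewrite ?size_map.
move=> [|x a] [|y b] //= [sa] [sb].
have [x0 | x_nz] := eqVneq x T0; last exact: Qnz.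
have [y0 | y_nz] := eqVneq y T0; last by apply: swapQ; apply: Qnz.
rewrite x0 y0; apply: (IHn (fun a b => Q (T0 :: a) (T0 :: b))) => // [c e|c e|c e|p p_n].
- exact: swapQ.
- by move=> Qce; apply: negQ.
- by move=> Qce; apply: addQ.
by apply: (rrefQ (T0 :: p.1, T0 :: p.2)); rewrite mem_cat map_f.
Qed.

Lemma size_rref n p : p \in rref n -> size p.1 = n /\ size p.2 = n.
Proof.
elim: n p => [|n IHn] p /=; first by rewrite inE => /eqP ->.
rewrite mem_cat => /orP[/mapP[q /IHn[s1 s2] ->] | /allpairsPdep[b [a [b_n a_n ->]]]] /=.
  by rewrite s1 s2.
move: b_n a_n; rewrite !mem_filter !mem_all_trits.
by move=> /andP[_ /eqP ->] /andP[_ /eqP ->].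
Qed.

Lemma apmcf_at_add (K : finFieldType) m n k (G : 'M[K]_(k, n)) R lambda
    (A : 'M_(m, n)) (U : 'M_(m, k)) :
  apmcf_at G R lambda (A + U *m G) = apmcf_at G R lambda A.
Proof. by rewrite /apmcf_at !near_words_add. Qed.

Lemma apmcf_at_unitmx (K : finFieldType) m n k (G : 'M[K]_(k, n)) R lambda
    (A : 'M_(m, n)) (D : 'M_m) : D \in unitmx ->
  apmcf_at G R lambda (D *m A) = apmcf_at G R lambda A.
Proof. by move=> unitD; rewrite /apmcf_at !near_words_unitmx. Qed.

Lemma mx1 n l : mx 1 n [:: l] = vec n l.
Proof. by apply/rowP => i; rewrite !mxE. Qed.

Section RowOperations.
Variable R : comUnitRingType.

Lemma swap_mx_unit : block_mx 0 1%:M 1%:M 0 \in @unitmx R (1 + 1).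
Proof.
suff /mulmx1_unit[] :
  block_mx 0 1%:M 1%:M 0 *m block_mx 0 1%:M 1%:M 0 = 1%:M :> 'M[R]_(1 + 1) by [].
by rewrite mulmx_block !mul0mx !mulmx0 !mul1mx !add0r !addr0 -scalar_mx_block.
Qed.

Lemma neg_mx_unit : block_mx (- 1%:M) 0 0 1%:M \in @unitmx R (1 + 1).
Proof. by rewrite unitmxE det_lblock -scaleN1r detZ !det1 !mulr1 expr1 unitrN1. Qed.

Lemma transvection_mx_unit : block_mx 1%:M 0 1%:M 1%:M \in @unitmx R (1 + 1).
Proof. by rewrite unitmxE det_lblock !det1 mulr1 unitr1. Qed.

End RowOperations.

(** The span of [Tl] contains a representative of every coset of the code. *)
Definition cosets_check R lambda Gl Tl :=
  all (fun l => apmcf_counts R lambda (all_supports R Gl [:: l])) (coset Tl [::]).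

Section SmallFields.
Variables (n k r d : nat) (C : {vspace 'rV['F_3]_n}) (Gl Tl : seq (seq trit)).
Hypothesis presC : presentation k r C Gl Tl.
Hypothesis validC : valid_lists n k r Gl Tl.
Hypothesis weightsG : weights_check Gl d.
Let G := mx k n Gl.
Let T := mx r n Tl.

Let sizeT : size Tl = r. Proof. by case/and5P: validC => _ /eqP. Qed.
Let shortT : all (fun g => size g <= n)%N Tl. Proof. by case/and5P: validC. Qed.

(** The coset check bounds the covering radius by R; [l0] shows that R is attained. *)
Lemma prime_field_params R lambda l0 :
  cosets_check R lambda Gl Tl -> (size l0 <= n)%N ->
  ~~ has (fun b => count id b < R)%N (all_supports R Gl [:: l0]) ->
  code_params C k d R /\ APMCF C R lambda.
Proof.
move=> /allP goodT l0_n far0.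
have card3 : #|'F_3| = (3 ^ 1)%N by rewrite card_Fp.
have shortl0 : all (fun a => size a <= n)%N [:: l0] by rewrite /= l0_n.
have := @lifted_params n k r d C Gl Tl presC validC weightsG 'F_3 idfun 1%N isT card3 R lambda.
rewrite lifted_id; apply; last by exists (mx 1 n [:: l0]); exact: (far_list validC shortl0).
move=> A; have [U [Y ->]] := presentation_gen presC A.
(* The enumeration runs over 0 - y T, so Y T is reached at y = -Y. *)
rewrite addrC apmcf_at_add; have := @coset_all n r Tl [::] (apmcf_at G R lambda) sizeT.
rewrite vec_nil => /(_ _ (- Y)); rewrite sub0r mulNmx opprK; apply.
apply/allP => l l_T; rewrite -mx1.
rewrite (apmcf_at_list validC R lambda (A := [:: l])); first exact: goodT.
by rewrite /= (size_supp_coset shortT).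
Qed.

(* Row operations preserve the distances, so over a quadratic extension it is
   enough to inspect the pairs of rows in reduced echelon form. *)
Lemma square_params R lambda (ext : seq trit -> seq trit) (p0 : seq trit * seq trit)
    (L : finFieldType) (iota : {rmorphism 'F_3 -> L}) :
  (forall a, size a = r -> vec n (ext a) = vec r a *m T) ->
  (forall a, size a = r -> (size (ext a) <= n)%N) ->
  all (fun p => apmcf_counts R lambda (all_supports R Gl [:: ext p.1; ext p.2])) (rref r) ->
  size p0.1 = r -> size p0.2 = r ->
  ~~ has (fun b => count id b < R)%N (all_supports R Gl [:: ext p0.1; ext p0.2]) ->
  #|L| = (3 ^ 2)%N ->
  code_params (lifted iota C) k d R /\ APMCF (lifted iota C) R lambda.
Proof.
move=> extT ext_n /allP goodT s1 s2 far0 card9.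
apply: (lifted_params presC validC weightsG _ _ card9) => //; last first.
  exists (mx 2 n [:: ext p0.1; ext p0.2]).
  by apply: (far_list validC (A := [:: _; _])); rewrite //= !ext_n.
(* Reduction acts on the coefficient rows a, b of the coset representative; each row operation is a
   left multiplication by an invertible 2 x 2 matrix. *)
pose Q a b := apmcf_at G R lambda (col_mx (vec r a *m T) (vec r b *m T) : 'M_(1 + 1, n)).
have unitQ (D : 'M_(1 + 1)) a b a' b' : D \in unitmx ->
    D *m col_mx (vec r a *m T) (vec r b *m T) = col_mx (vec r a' *m T) (vec r b' *m T) ->
    Q a' b' -> Q a b.
  by move=> unitD eqD; rewrite /Q -eqD apmcf_at_unitmx.
have allQ a b : size a = r -> size b = r -> Q a b.
  apply: (@rref_ind r Q) => [{}a {}b | {}a {}b | {}a {}b |].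
  - apply: (unitQ _ _ _ _ _ (swap_mx_unit _)).
    by rewrite mul_block_col !mul0mx !mul1mx add0r addr0.
  - apply: (unitQ _ _ _ _ _ (neg_mx_unit _)).
    by rewrite mul_block_col !mul0mx !mulNmx !mul1mx add0r addr0 vecN mulNmx.
  - apply: (unitQ _ _ _ _ _ (transvection_mx_unit _)).
    by rewrite mul_block_col !mul0mx !mul1mx addr0 vecD mulmxDl addrC.
  move=> ab ab_r; have [sa sb] := size_rref ab_r.
  rewrite /Q -!extT // -(mx1 _ (ext ab.2)) -mx_cons.
  rewrite (apmcf_at_list validC R lambda (A := [:: _; _])); first exact: goodT.
  by rewrite /= !ext_n.
move=> A; have [U [Y ->]] := presentation_gen presC A.
rewrite addrC apmcf_at_add.
have := vsubmxK (Y : 'M_(1 + 1, r)); move: (usubmx _) (dsubmx _) => y1 y2 <-.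
have [a sa ->] := vec_onto y1; have [b sb ->] := vec_onto y2.
have := allQ a b sa sb; by rewrite /Q -mul_col_mx.
Qed.

End SmallFields.

(** * Systematic generators and the Golay codes *)

Lemma mem_code_of (F : finFieldType) k n (G : 'M[F]_(k, n)) x :
  x \in code_of G <-> exists u, x = u *m G.
Proof.
split=> [x_G | [u ->]]; last first.
  rewrite mulmx_sum_row memv_suml // => i _; rewrite memvZ // memv_span //.
  by apply: map_f; rewrite mem_enum.
have [u _ ->] : exists2 u, u \in fullv & x = linfun (mulmxr G) u.
  apply/memv_imgP; apply: subvP x_G; apply/span_subvP => _ /mapP[i _ ->].
  have -> : row i G = linfun (mulmxr G) (delta_mx 0 i) by rewrite lfunE /= -rowE.
  exact/memv_img/memvf.
by exists u; rewrite lfunE.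
Qed.

Lemma puncture_code_of (F : finFieldType) k n s (G : 'M[F]_(k, n + s)) :
  puncture (code_of G) = code_of (lsubmx G).
Proof.
have lsubM (u : 'rV_k) : lsubmx (u *m G) = u *m lsubmx G.
  by rewrite -{1}[G]hsubmxK mul_mx_row row_mxKl.
apply/vspaceP => x; apply/memv_imgP/idP => [[c /mem_code_of[u ->] ->] | /mem_code_of[u ->]].
  by rewrite lfunE /= lsubM; apply/mem_code_of; exists u.
by exists (u *m G); [apply/mem_code_of; exists u | rewrite lfunE /= lsubM].
Qed.

Definition unit_list n i := mkseq (fun j => if j == i then T1 else T0) n.
(** These four lists stand for [I | M] with complement [0 | I], and for the dual [-M^T | I] with
    complement [I | 0]. *)
Definition sys_gen k r M :=
  mkseq (fun i => unit_list k i ++ mkseq (fun j => nth T0 (nth [::] M i) j) r) k.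
Definition sys_compl k r := mkseq (fun i => nseq k T0 ++ unit_list r i) r.
Definition dual_gen k r M :=
  mkseq (fun i => mkseq (fun j => tneg (nth T0 (nth [::] M j) i)) k ++ unit_list r i) r.
Definition dual_compl k := mkseq (unit_list k) k.

Lemma F3_if (b : bool) : F3 (if b then T1 else T0) = b%:R.
Proof. by case: b; rewrite ?F3_0 ?F3_1. Qed.

(** Columns beyond k + r are dropped by [mx], which is what puncturing does to the generator
    matrix. *)
Lemma mx_sys_gen k r s M : (r <= s)%N ->
  mx k (k + r) (sys_gen k s M) = row_mx 1%:M (mx k r M).
Proof.
move=> r_s; apply/matrixP => i j; rewrite [LHS]mxE [RHS]mxE nth_mkseq // nth_cat size_mkseq.
case: splitP => j' ->; rewrite [RHS]mxE.
  by rewrite nth_mkseq // F3_if eq_sym.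
by rewrite addKn nth_mkseq // (leq_trans (ltn_ord j')).
Qed.

Lemma mx_sys_compl k r : mx r (k + r) (sys_compl k r) = row_mx 0 1%:M.
Proof.
apply/matrixP => i j; rewrite [LHS]mxE [RHS]mxE nth_mkseq // nth_cat size_nseq.
case: splitP => j' ->; rewrite [RHS]mxE.
  by rewrite nth_nseq if_same F3_0.
by rewrite addKn nth_mkseq // F3_if eq_sym.
Qed.

Lemma mx_dual_gen k r M : mx r (k + r) (dual_gen k r M) = row_mx (- (mx k r M)^T) 1%:M.
Proof.
apply/matrixP => i j; rewrite [LHS]mxE [RHS]mxE nth_mkseq // nth_cat size_mkseq.
case: splitP => j' ->; rewrite [RHS]mxE.
  by rewrite nth_mkseq // F3N [_^T _ _]mxE mxE.
by rewrite addKn nth_mkseq // F3_if eq_sym.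
Qed.

Lemma mx_dual_compl k r : mx k (k + r) (dual_compl k) = row_mx 1%:M 0.
Proof.
apply/matrixP => i j; rewrite [LHS]mxE [RHS]mxE nth_mkseq //.
case: splitP => j' ->; rewrite [RHS]mxE; first by rewrite nth_mkseq // F3_if eq_sym.
by rewrite nth_default ?size_mkseq ?leq_addr // F3_0.
Qed.

(** The decomposition is [A1 | A2] = A1 [I | M] + (A2 - A1 M) [0 | I]. *)
Lemma sys_presentation k r M :
  presentation k r (code_of (row_mx 1%:M (mx k r M))) (sys_gen k r M) (sys_compl k r).
Proof.
split=> [x | m A]; first by rewrite mx_sys_gen //; exact: mem_code_of.
exists (lsubmx A), (rsubmx A - lsubmx A *m mx k r M).
rewrite mx_sys_gen // mx_sys_compl !mul_mx_row !mulmx1 mulmx0 add_row_mx addr0.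
by rewrite addrC subrK hsubmxK.
Qed.

(** A row [x1 | x2] is dual to [I | M] exactly when x1 = - x2 M^T. *)
Lemma dual_presentation k r M :
  presentation r k (dual (code_of (row_mx 1%:M (mx k r M)))) (dual_gen k r M) (dual_compl k).
Proof.
split=> [x | m A]; last first.
  exists (rsubmx A), (lsubmx A + rsubmx A *m (mx k r M)^T).
  rewrite mx_dual_gen mx_dual_compl !mul_mx_row !mulmx1 mulmx0 add_row_mx addr0.
  by rewrite mulmxN addrC addrK hsubmxK.
have -> : x \in dual (code_of (row_mx 1%:M (mx k r M))) = (row_mx 1%:M (mx k r M) *m x^T == 0).
  apply/mem_dualP/eqP => [dual_x | Gx c /mem_code_of[u ->]]; last by rewrite -mulmxA Gx mulmx0.
  apply/row_matrixP => i; rewrite row0 row_mul; apply: dual_x; apply/mem_code_of.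
  by exists (delta_mx 0 i); rewrite rowE.
rewrite mx_dual_gen -{1}[x]hsubmxK tr_row_mx mul_row_col mul1mx addr_eq0; split.
  move/eqP => eq_l; exists (rsubmx x); rewrite mul_mx_row mulmx1.
  by rewrite -{1}[x]hsubmxK; congr row_mx; apply/trmx_inj;
    rewrite eq_l mulmxN [(- _)^T]linearN /= trmx_mul trmxK.
case=> u ->; rewrite mul_mx_row row_mxKl row_mxKr mulmx1.
by rewrite mulmxN [(- _)^T]linearN /= trmx_mul trmxK.
Qed.

Lemma mx_of_rowsE k n M : mx_of_rows k n (map (map nat_of_trit) M) = mx k n M.
Proof.
apply/matrixP => i j; rewrite !mxE /F3; congr (_%:R).
elim: M (i : nat) => [|a M IHM] [|i'] //=; try by rewrite !nth_nil.
by elim: a (j : nat) => [|x a IHa] [|j'] /=.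
Qed.

Definition T11 : seq (seq trit) := map (map trit_of_nat)
  [:: [:: 2; 2; 2; 2; 2];
      [:: 2; 2; 1; 1; 0];
      [:: 2; 1; 2; 0; 1];
      [:: 1; 2; 0; 2; 1];
      [:: 1; 0; 2; 1; 2];
      [:: 0; 1; 1; 2; 2]]%N.

Definition T12 : seq (seq trit) := map (map trit_of_nat)
  [:: [:: 0; 1; 1; 1; 1; 1];
      [:: 1; 0; 1; 2; 2; 1];
      [:: 1; 1; 0; 1; 2; 2];
      [:: 1; 2; 1; 0; 1; 2];
      [:: 1; 2; 2; 1; 0; 1];
      [:: 1; 1; 2; 2; 1; 0]]%N.

Lemma G12E : G12 = code_of (row_mx 1%:M (mx 6 6 T12)).
Proof. by rewrite /G12 -mx_of_rowsE. Qed.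

Lemma G11E : G11 = code_of (row_mx 1%:M (mx 6 5 T11)).
Proof. by rewrite /G11 -mx_of_rowsE. Qed.

(** For numerals [6 + r + s] reduces to 11, so the three punctured codes are instances up to
    conversion. *)
Lemma puncture_G11 r s (eq_rs : (r + s = 5)%N) :
  puncture (code_of (mx 6 (6 + r + s) (sys_gen 6 5 T11))) = code_of (row_mx 1%:M (mx 6 r T11)).
Proof.
rewrite puncture_code_of -(@mx_sys_gen _ r 5); last by rewrite -eq_rs leq_addr.
by congr code_of; apply/matrixP => i j; rewrite !mxE.
Qed.

Lemma G11_listE : G11 = code_of (mx 6 (6 + 5) (sys_gen 6 5 T11)).
Proof. by rewrite mx_sys_gen // G11E. Qed.

Lemma G10E : G10 = code_of (row_mx 1%:M (mx 6 4 T11)).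
Proof. by rewrite /G10 G11_listE; exact: (@puncture_G11 4 1 erefl). Qed.

Lemma G9E : G9 = code_of (row_mx 1%:M (mx 6 3 T11)).
Proof. by rewrite /G9 G11_listE; exact: (@puncture_G11 3 2 erefl). Qed.

Lemma G8E : G8 = code_of (row_mx 1%:M (mx 6 2 T11)).
Proof. by rewrite /G8 G11_listE; exact: (@puncture_G11 2 3 erefl). Qed.

(** * Computations *)

(** Each check is a closed boolean, evaluated by the virtual machine when the kernel checks the
    term. *)
Ltac compute_check := by vm_cast_no_check (erefl true).

Definition trits := map trit_of_nat.

Lemma valid12 : valid_lists 12 6 6 (sys_gen 6 6 T12) (sys_compl 6 6).
Proof. compute_check. Qed.
Lemma weights12 : weights_check (sys_gen 6 6 T12) 6. Proof. compute_check. Qed.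
(** With the six unit rows on the check coordinates no nonzero dual word is orthogonal to all rows,
    and a dual of dimension 6 has a nonzero word vanishing on any 5 coordinates. *)
Lemma far12 : far_check 12 6 (sys_gen 6 6 T12) (dual_gen 6 6 T12) (sys_compl 6 6).
Proof. compute_check. Qed.
Lemma cosets12 : cosets_check 3 4 (sys_gen 6 6 T12) (sys_compl 6 6).
Proof. compute_check. Qed.

Lemma valid_sys11 r : (r <= 5)%N -> valid_lists (6 + r) 6 r (sys_gen 6 r T11) (sys_compl 6 r).
Proof. by case: r => [|[|[|[|[|[|]]]]]] // _; compute_check. Qed.
Lemma valid_dual11 r : (r <= 5)%N -> valid_lists (6 + r) r 6 (dual_gen 6 r T11) (dual_compl 6).
Proof. by case: r => [|[|[|[|[|[|]]]]]] // _; compute_check. Qed.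

Lemma weights11 : weights_check (sys_gen 6 5 T11) 5. Proof. compute_check. Qed.
Lemma weights10 : weights_check (sys_gen 6 4 T11) 4. Proof. compute_check. Qed.
Lemma weights9 : weights_check (sys_gen 6 3 T11) 3. Proof. compute_check. Qed.
Lemma weights8 : weights_check (sys_gen 6 2 T11) 2. Proof. compute_check. Qed.
Lemma weights10_dual : weights_check (dual_gen 6 4 T11) 6. Proof. compute_check. Qed.
Lemma weights9_dual : weights_check (dual_gen 6 3 T11) 6. Proof. compute_check. Qed.
Lemma weights8_dual : weights_check (dual_gen 6 2 T11) 6. Proof. compute_check. Qed.

(** Explicit far points with as many rows as the least m for which each is used. The rows lie in the
    chosen complement: the check coordinates for the codes, the first six for the duals. *)
Definition far11_rows := map trits
  [:: [:: 0; 0; 0; 0; 0; 0; 0; 0; 0; 1; 0];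
      [:: 0; 0; 0; 0; 0; 0; 2; 2; 1; 2; 1];
      [:: 0; 0; 0; 0; 0; 0; 2; 1; 2; 2; 1];
      [:: 0; 0; 0; 0; 0; 0; 1; 1; 1; 1; 0]]%N.
Definition far10_rows := map trits
  [:: [:: 0; 0; 0; 0; 0; 0; 1; 0; 2; 0];
      [:: 0; 0; 0; 0; 0; 0; 2; 1; 2; 1];
      [:: 0; 0; 0; 0; 0; 0; 1; 0; 0; 2]]%N.
Definition far9_rows := map trits
  [:: [:: 0; 0; 0; 0; 0; 0; 0; 2; 1];
      [:: 0; 0; 0; 0; 0; 0; 2; 0; 2]]%N.
Definition far10_dual_rows := map trits
  [:: [:: 2; 2; 0; 0; 1; 1; 0; 0; 0; 0]; [:: 0; 1; 1; 1; 1; 1; 0; 0; 0; 0]]%N.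
Definition far9_dual_rows := map trits
  [:: [:: 1; 1; 1; 0; 0; 1; 0; 0; 0]; [:: 0; 2; 1; 2; 1; 0; 0; 0; 0]]%N.
Definition far8_dual_rows := map trits
  [:: [:: 0; 1; 2; 2; 1; 1; 0; 0]; [:: 1; 1; 0; 1; 1; 0; 0; 0]]%N.

Lemma far11 : far_check 11 5 (sys_gen 6 5 T11) (dual_gen 6 5 T11) far11_rows.
Proof. compute_check. Qed.
Lemma far10 : far_check 10 4 (sys_gen 6 4 T11) (dual_gen 6 4 T11) far10_rows.
Proof. compute_check. Qed.
Lemma far9 : far_check 9 3 (sys_gen 6 3 T11) (dual_gen 6 3 T11) far9_rows.
Proof. compute_check. Qed.
Lemma far8 : far_check 8 2 (sys_gen 6 2 T11) (dual_gen 6 2 T11) (sys_compl 6 2).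
Proof. compute_check. Qed.
Lemma far10_dual : far_check 10 6 (dual_gen 6 4 T11) (sys_gen 6 4 T11) far10_dual_rows.
Proof. compute_check. Qed.
Lemma far9_dual : far_check 9 6 (dual_gen 6 3 T11) (sys_gen 6 3 T11) far9_dual_rows.
Proof. compute_check. Qed.
Lemma far8_dual : far_check 8 6 (dual_gen 6 2 T11) (sys_gen 6 2 T11) far8_dual_rows.
Proof. compute_check. Qed.

Lemma info10 : (num_info_list 10 (sys_gen 6 4 T11) 6 == 180)%N. Proof. compute_check. Qed.
Lemma info9 : (num_info_list 9 (sys_gen 6 3 T11) 6 == 72)%N. Proof. compute_check. Qed.
Lemma info8 : (num_info_list 8 (sys_gen 6 2 T11) 6 == 24)%N. Proof. compute_check. Qed.
(** The dual counts equal the primal ones, as complements of information sets are information sets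
    of the dual. *)
Lemma info10_dual : (num_info_list 10 (dual_gen 6 4 T11) 4 == 180)%N.
Proof. compute_check. Qed.
Lemma info9_dual : (num_info_list 9 (dual_gen 6 3 T11) 3 == 72)%N. Proof. compute_check. Qed.
Lemma info8_dual : (num_info_list 8 (dual_gen 6 2 T11) 2 == 24)%N. Proof. compute_check. Qed.

Lemma cosets11 : cosets_check 2 1 (sys_gen 6 5 T11) (sys_compl 6 5). Proof. compute_check. Qed.
Lemma cosets10 : cosets_check 2 3 (sys_gen 6 4 T11) (sys_compl 6 4). Proof. compute_check. Qed.
Lemma cosets9 : cosets_check 2 9 (sys_gen 6 3 T11) (sys_compl 6 3). Proof. compute_check. Qed.
Lemma cosets8 : cosets_check 1 2 (sys_gen 6 2 T11) (sys_compl 6 2). Proof. compute_check. Qed.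
Lemma cosets10_dual : cosets_check 5 36 (dual_gen 6 4 T11) (dual_compl 6).
Proof. compute_check. Qed.
Lemma cosets9_dual : cosets_check 5 18 (dual_gen 6 3 T11) (dual_compl 6).
Proof. compute_check. Qed.
Lemma cosets8_dual : cosets_check 5 8 (dual_gen 6 2 T11) (dual_compl 6).
Proof. compute_check. Qed.

Definition extend11 a := nseq 6 T0 ++ a.

Lemma pairs11 : all (fun p => apmcf_counts 4 30 (all_supports 4 (sys_gen 6 5 T11)
  [:: extend11 p.1; extend11 p.2])) (rref 5).
Proof. compute_check. Qed.

Definition combination (s : seq (nat * seq (seq nat))) : seq (nat * seq (seq trit)) :=
  [seq (p.1, map trits p.2) | p <- s].
(** Multipliers and points for the failure of UPWS: both sides have equal counts at every distance
    up to R, but the multipliers sum differently, here to 19 against 20. *)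
Definition weights10_dual_1_pos := combination
  [:: (4, [:: [:: 1; 1; 0; 0; 2; 2; 0; 0; 0; 0]]);
      (15, [:: [:: 0; 0; 0; 1; 1; 1; 0; 0; 0; 0]])]%N.
Definition weights10_dual_1_neg := combination
  [:: (10, [:: [:: 0; 0; 0; 1; 2; 1; 0; 0; 0; 0]]);
      (10, [:: [:: 0; 0; 1; 1; 1; 1; 0; 0; 0; 0]])]%N.
Definition weights9_dual_1_pos := combination
  [:: (5, [:: [:: 0; 0; 1; 0; 1; 2; 0; 0; 0]]);
      (3, [:: [:: 0; 0; 0; 0; 1; 2; 0; 0; 0]]);
      (9, [:: [:: 0; 0; 0; 1; 1; 2; 0; 0; 0]])]%N.
Definition weights9_dual_1_neg := combination
  [:: (12, [:: [:: 0; 0; 0; 1; 1; 1; 0; 0; 0]]);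
      (3, [:: [:: 0; 0; 0; 0; 1; 1; 0; 0; 0]])]%N.
Definition weights8_dual_1_pos := combination
  [:: (14, [:: [:: 0; 0; 1; 1; 0; 1; 0; 0]]);
      (3, [:: [:: 0; 0; 0; 1; 2; 1; 0; 0]]);
      (8, [:: [:: 0; 0; 1; 1; 0; 0; 0; 0]])]%N.
Definition weights8_dual_1_neg := combination
  [:: (20, [:: [:: 0; 0; 0; 1; 1; 1; 0; 0]]);
      (8, [:: [:: 0; 0; 0; 0; 1; 1; 0; 0]])]%N.
Definition weights10_dual_2_pos := combination
  [:: (3, [:: [:: 2; 1; 2; 0; 0; 0; 0; 0; 0; 0]; [:: 2; 1; 2; 0; 0; 0; 0; 0; 0; 0]]);
      (139, [:: [:: 0; 0; 0; 1; 0; 0; 0; 0; 0; 0]; [:: 2; 2; 1; 0; 0; 0; 0; 0; 0; 0]]);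
      (64, [:: [:: 0; 1; 1; 0; 0; 0; 0; 0; 0; 0]; [:: 2; 1; 2; 0; 0; 0; 0; 0; 0; 0]]);
      (1, [:: [:: 2; 0; 2; 0; 0; 0; 0; 0; 0; 0]; [:: 0; 1; 1; 0; 0; 0; 0; 0; 0; 0]])]%N.
Definition weights10_dual_2_neg := combination
  [:: (213, [:: [:: 1; 1; 2; 0; 0; 0; 0; 0; 0; 0]; [:: 1; 0; 2; 0; 0; 0; 0; 0; 0; 0]])]%N.
Definition weights9_dual_2_pos := combination
  [:: (1, [:: [:: 0; 0; 0; 0; 0; 0; 0; 0; 0]; [:: 1; 2; 2; 0; 0; 0; 0; 0; 0]]);
      (9, [:: [:: 0; 0; 0; 1; 0; 0; 0; 0; 0]; [:: 2; 2; 1; 0; 0; 0; 0; 0; 0]]);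
      (11, [:: [:: 0; 1; 1; 0; 0; 0; 0; 0; 0]; [:: 2; 1; 2; 0; 0; 0; 0; 0; 0]]);
      (1, [:: [:: 2; 1; 2; 0; 0; 0; 0; 0; 0]; [:: 2; 1; 2; 0; 0; 0; 0; 0; 0]])]%N.
Definition weights9_dual_2_neg := combination
  [:: (23, [:: [:: 1; 1; 2; 0; 0; 0; 0; 0; 0]; [:: 1; 0; 2; 0; 0; 0; 0; 0; 0]])]%N.
Definition weights8_dual_2_pos := combination
  [:: (1, [:: [:: 1; 1; 0; 0; 0; 0; 0; 0]; [:: 1; 1; 0; 0; 0; 0; 0; 0]]);
      (3, [:: [:: 0; 2; 0; 0; 0; 0; 0; 0]; [:: 0; 2; 2; 0; 0; 0; 0; 0]]);
      (12, [:: [:: 2; 1; 2; 0; 0; 0; 0; 0]; [:: 2; 0; 0; 0; 0; 0; 0; 0]]);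
      (3, [:: [:: 1; 0; 0; 1; 0; 0; 0; 0]; [:: 0; 2; 1; 0; 0; 0; 0; 0]])]%N.
Definition weights8_dual_2_neg := combination
  [:: (12, [:: [:: 0; 0; 0; 1; 0; 0; 0; 0]; [:: 2; 2; 1; 0; 0; 0; 0; 0]]);
      (4, [:: [:: 2; 2; 0; 0; 0; 0; 0; 0]; [:: 0; 1; 0; 0; 0; 0; 0; 0]])]%N.
Definition weights11_2_pos := combination
  [:: (3, [:: [:: 0; 0; 0; 0; 0; 0; 2; 0; 0; 1; 0]; [:: 0; 0; 0; 0; 0; 0; 1; 2; 1; 1; 1]]);
      (2, [:: [:: 0; 0; 0; 0; 0; 0; 1; 1; 0; 1; 1]; [:: 0; 0; 0; 0; 0; 0; 1; 1; 1; 0; 2]])]%N.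
Definition weights11_2_neg := combination
  [:: (6, [:: [:: 0; 0; 0; 0; 0; 0; 1; 2; 0; 1; 0]; [:: 0; 0; 0; 0; 0; 0; 2; 2; 2; 0; 0]])]%N.

Lemma upws10_dual_1 :
  upws_check 10 1 5 (dual_gen 6 4 T11) weights10_dual_1_pos weights10_dual_1_neg.
Proof. compute_check. Qed.
Lemma upws9_dual_1 :
  upws_check 9 1 5 (dual_gen 6 3 T11) weights9_dual_1_pos weights9_dual_1_neg.
Proof. compute_check. Qed.
Lemma upws8_dual_1 :
  upws_check 8 1 5 (dual_gen 6 2 T11) weights8_dual_1_pos weights8_dual_1_neg.
Proof. compute_check. Qed.
Lemma upws10_dual_2 :
  upws_check 10 2 6 (dual_gen 6 4 T11) weights10_dual_2_pos weights10_dual_2_neg.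
Proof. compute_check. Qed.
Lemma upws9_dual_2 :
  upws_check 9 2 6 (dual_gen 6 3 T11) weights9_dual_2_pos weights9_dual_2_neg.
Proof. compute_check. Qed.
Lemma upws8_dual_2 :
  upws_check 8 2 6 (dual_gen 6 2 T11) weights8_dual_2_pos weights8_dual_2_neg.
Proof. compute_check. Qed.
Lemma upws11_2 : upws_check 11 2 4 (sys_gen 6 5 T11) weights11_2_pos weights11_2_neg.
Proof. compute_check. Qed.

Lemma not_upws_base n k r d (C : {vspace 'rV['F_3]_n}) Gl Tl (R : nat) P N :
  presentation k r C Gl Tl -> valid_lists n k r Gl Tl -> weights_check Gl d ->
  upws_check n 1 R Gl P N -> covering_radius C = R -> ~ UPWS C.
Proof.
move=> presC validC weightsC checkPN; rewrite -{1 2}(lifted_id C).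
by apply: (not_UPWS_list presC validC weightsC _ checkPN); rewrite card_Fp.
Qed.

Definition present12 := sys_presentation 6 6 T12.
Definition present11 r := sys_presentation 6 r T11.
Definition present11_dual r := dual_presentation 6 r T11.

Lemma vec_nseq_cat k r a :
  vec (k + r) (nseq k T0 ++ a) = vec r a *m mx r (k + r) (sys_compl k r).
Proof.
rewrite mx_sys_compl mul_mx_row mulmx0 mulmx1.
apply/rowP => i; rewrite [LHS]mxE [RHS]mxE nth_cat size_nseq.
case: splitP => j ->; first by rewrite nth_nseq if_same F3_0 mxE.
by rewrite mxE addKn.
Qed.

(** * Parameters of the ternary codes and their duals *)

Lemma PMCF_params n (C : {vspace 'rV['F_3]_n}) k d R lambda : (2 * R <= d)%N ->
  code_params C k d R /\ APMCF C R lambda -> code_params C k d R /\ PMCF C R lambda.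
Proof. by move=> Rd [par apmcf]; split=> //; split=> //; case: par => _ ->. Qed.

Lemma G12_params : code_params G12 6 6 3 /\ PMCF G12 3 4.
Proof.
apply: PMCF_params => //; rewrite G12E.
(* Here and below [l0] is an explicit point at distance R from the code. *)
by apply: (prime_field_params present12 valid12 weights12
  (l0 := nseq 9 T0 ++ nseq 3 T1) cosets12).
Qed.

Lemma G11_params : code_params G11 6 5 2 /\ PMCF G11 2 1.
Proof.
apply: PMCF_params => //; rewrite G11E.
by apply: (prime_field_params (present11 5) (valid_sys11 _) weights11
  (l0 := nseq 9 T0 ++ nseq 2 T1) cosets11).
Qed.

Lemma G10_params : code_params G10 6 4 2 /\ PMCF G10 2 3.
Proof.
apply: PMCF_params => //; rewrite G10E.
by apply: (prime_field_params (present11 4) (valid_sys11 _) weights10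
  (l0 := nseq 8 T0 ++ nseq 2 T1) cosets10).
Qed.

Lemma G9_params : code_params G9 6 3 2 /\ APMCF G9 2 9.
Proof.
rewrite G9E.
by apply: (prime_field_params (present11 3) (valid_sys11 _) weights9
  (l0 := nseq 7 T0 ++ [:: T1; T2]) cosets9).
Qed.

Lemma G8_params : code_params G8 6 2 1 /\ PMCF G8 1 2.
Proof.
apply: PMCF_params => //; rewrite G8E.
by apply: (prime_field_params (present11 2) (valid_sys11 _) weights8
  (l0 := nseq 7 T0 ++ [:: T1]) cosets8).
Qed.

Lemma dual_G10_params : code_params (dual G10) 4 6 5 /\ APMCF (dual G10) 5 36.
Proof.
rewrite G10E.
by apply: (prime_field_params (present11_dual 4) (valid_dual11 _) weights10_dual
  (l0 := T0 :: nseq 5 T1) cosets10_dual).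
Qed.

Lemma dual_G9_params : code_params (dual G9) 3 6 5 /\ APMCF (dual G9) 5 18.
Proof.
rewrite G9E.
by apply: (prime_field_params (present11_dual 3) (valid_dual11 _) weights9_dual
  (l0 := T0 :: nseq 5 T1) cosets9_dual).
Qed.

Lemma dual_G8_params : code_params (dual G8) 2 6 5 /\ APMCF (dual G8) 5 8.
Proof.
rewrite G8E.
by apply: (prime_field_params (present11_dual 2) (valid_dual11 _) weights8_dual
  (l0 := T0 :: nseq 5 T1) cosets8_dual).
Qed.

(** * Lifted codes that attain the redundancy bound *)

Section Lifted.
Variables (m : nat) (F : finFieldType) (iota : {rmorphism 'F_3 -> F}).
Hypothesis cardF : #|F| = (3 ^ m)%N.

Lemma lifted_G12 : (6 <= m)%N -> code_params (lifted iota G12) 6 6 6 /\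
  APMCF (lifted iota G12) 6 (num_info_mx 12 6 (sys_gen 6 6 T12)).
Proof.
move=> le_m; rewrite G12E.
apply: (lifted_params_redundancy present12 valid12 weights12 iota _ cardF _ _ _ far12) => //.
exact: leq_trans le_m.
Qed.

Lemma lifted_G11 : (4 <= m)%N -> code_params (lifted iota G11) 6 5 5 /\
  APMCF (lifted iota G11) 5 (num_info_mx 11 6 (sys_gen 6 5 T11)).
Proof.
move=> le_m; rewrite G11E.
apply: (lifted_params_redundancy (present11 5) (valid_sys11 _) weights11
  iota _ cardF _ _ _ far11) => //.
exact: leq_trans le_m.
Qed.

Lemma lifted_G10 : (3 <= m)%N -> code_params (lifted iota G10) 6 4 4 /\
  APMCF (lifted iota G10) 4 180.
Proof.
move=> le_m; rewrite G10E.
have <- : num_info_mx 10 6 (sys_gen 6 4 T11) = 180%N.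
  by rewrite (num_info_mxE (valid_sys11 (r := 4) _)) // (eqP info10).
apply: (lifted_params_redundancy (present11 4) (valid_sys11 _) weights10
  iota _ cardF _ _ _ far10) => //.
exact: leq_trans le_m.
Qed.

Lemma lifted_G9 : (2 <= m)%N -> code_params (lifted iota G9) 6 3 3 /\
  APMCF (lifted iota G9) 3 72.
Proof.
move=> le_m; rewrite G9E.
have <- : num_info_mx 9 6 (sys_gen 6 3 T11) = 72%N.
  by rewrite (num_info_mxE (valid_sys11 (r := 3) _)) // (eqP info9).
apply: (lifted_params_redundancy (present11 3) (valid_sys11 _) weights9
  iota _ cardF _ _ _ far9) => //.
exact: leq_trans le_m.
Qed.

Lemma lifted_G8 : (2 <= m)%N -> code_params (lifted iota G8) 6 2 2 /\
  APMCF (lifted iota G8) 2 24.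
Proof.
move=> le_m; rewrite G8E.
have <- : num_info_mx 8 6 (sys_gen 6 2 T11) = 24%N.
  by rewrite (num_info_mxE (valid_sys11 (r := 2) _)) // (eqP info8).
apply: (lifted_params_redundancy (present11 2) (valid_sys11 _) weights8
  iota _ cardF _ _ _ far8) => //.
exact: leq_trans le_m.
Qed.

Lemma lifted_dual_G10 : (2 <= m)%N -> code_params (lifted iota (dual G10)) 4 6 6 /\
  APMCF (lifted iota (dual G10)) 6 180.
Proof.
move=> le_m; rewrite G10E.
have <- : num_info_mx 10 4 (dual_gen 6 4 T11) = 180%N.
  by rewrite (num_info_mxE (valid_dual11 (r := 4) _)) // (eqP info10_dual).
apply: (lifted_params_redundancy (present11_dual 4) (valid_dual11 _) weights10_dual
  iota _ cardF _ _ _ far10_dual) => //.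
exact: leq_trans le_m.
Qed.

Lemma lifted_dual_G9 : (2 <= m)%N -> code_params (lifted iota (dual G9)) 3 6 6 /\
  APMCF (lifted iota (dual G9)) 6 72.
Proof.
move=> le_m; rewrite G9E.
have <- : num_info_mx 9 3 (dual_gen 6 3 T11) = 72%N.
  by rewrite (num_info_mxE (valid_dual11 (r := 3) _)) // (eqP info9_dual).
apply: (lifted_params_redundancy (present11_dual 3) (valid_dual11 _) weights9_dual
  iota _ cardF _ _ _ far9_dual) => //.
exact: leq_trans le_m.
Qed.

Lemma lifted_dual_G8 : (2 <= m)%N -> code_params (lifted iota (dual G8)) 2 6 6 /\
  APMCF (lifted iota (dual G8)) 6 24.
Proof.
move=> le_m; rewrite G8E.
have <- : num_info_mx 8 2 (dual_gen 6 2 T11) = 24%N.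
  by rewrite (num_info_mxE (valid_dual11 (r := 2) _)) // (eqP info8_dual).
apply: (lifted_params_redundancy (present11_dual 2) (valid_dual11 _) weights8_dual
  iota _ cardF _ _ _ far8_dual) => //.
exact: leq_trans le_m.
Qed.

End Lifted.

(** The radius 4 stays below the redundancy 5, so lambda comes from inspecting echelon pairs instead
    of counting information sets; [p0] is a pair at distance 4. *)
Lemma lifted_G11_square (F : finFieldType) (iota : {rmorphism 'F_3 -> F}) :
  #|F| = (3 ^ 2)%N ->
  code_params (lifted iota G11) 6 5 4 /\ APMCF (lifted iota G11) 4 30.
Proof.
move=> cardF; rewrite G11E.
apply: (square_params (ext := extend11)
  (p0 := (trits [:: 2; 0; 0; 1; 0]%N, trits [:: 1; 2; 1; 1; 1]%N))
  (present11 5) (valid_sys11 _) weights11 iota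
  (fun a _ => vec_nseq_cat 6 5 a) _ pairs11) => //.
by move=> a sa; rewrite size_cat size_nseq sa.
Qed.

Close Scope ring_scope.

Theorem theorem5p4 :
  ((* (i), length 12 *)
   [/\ code_params G12 6 6 3, PMCF G12 3 4 &
     exists lambda12 : nat -> nat,
       forall (m : nat) (F : finFieldType) (iota : {rmorphism 'F_3 -> F}),
         6 <= m -> #|F| = 3 ^ m ->
         code_params (lifted iota G12) 6 6 6 /\ APMCF (lifted iota G12) 6 (lambda12 m)] /\
   (* (i), length 11 *)
   [/\ code_params G11 6 5 2, PMCF G11 2 1 &
     exists lambda11 : nat -> nat,
       forall (m : nat) (F : finFieldType) (iota : {rmorphism 'F_3 -> F}),
         4 <= m -> #|F| = 3 ^ m ->
         code_params (lifted iota G11) 6 5 5 /\ APMCF (lifted iota G11) 5 (lambda11 m)] /\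
   (* (i), length 10 *)
   [/\ code_params G10 6 4 2, PMCF G10 2 3 &
     exists lambda10 : nat -> nat,
       (forall (m : nat) (F : finFieldType) (iota : {rmorphism 'F_3 -> F}),
          3 <= m -> #|F| = 3 ^ m ->
          code_params (lifted iota G10) 6 4 4 /\ APMCF (lifted iota G10) 4 (lambda10 m)) /\
       lambda10 3 = 180] /\
   (* (i), length 9 *)
   [/\ code_params G9 6 3 2, APMCF G9 2 9 &
     exists lambda9 : nat -> nat,
       (forall (m : nat) (F : finFieldType) (iota : {rmorphism 'F_3 -> F}),
          2 <= m -> #|F| = 3 ^ m ->
          code_params (lifted iota G9) 6 3 3 /\ APMCF (lifted iota G9) 3 (lambda9 m)) /\
       lambda9 2 = 72 /\ lambda9 3 = 72] /\
   (* (i), length 8 *)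
   [/\ code_params G8 6 2 1, PMCF G8 1 2 &
     exists lambda8 : nat -> nat,
       (forall (m : nat) (F : finFieldType) (iota : {rmorphism 'F_3 -> F}),
          2 <= m -> #|F| = 3 ^ m ->
          code_params (lifted iota G8) 6 2 2 /\ APMCF (lifted iota G8) 2 (lambda8 m)) /\
       lambda8 2 = 24 /\ lambda8 3 = 24]) /\
  ((* (ii), over the field with 3 elements *)
   [/\ code_params (dual G10) 4 6 5, APMCF (dual G10) 5 36 & ~ UPWS (dual G10)] /\
   [/\ code_params (dual G9) 3 6 5, APMCF (dual G9) 5 18 & ~ UPWS (dual G9)] /\
   [/\ code_params (dual G8) 2 6 5, APMCF (dual G8) 5 8 & ~ UPWS (dual G8)] /\
   (* (ii), over the field with 9 elements *)
   forall (F : finFieldType) (iota : {rmorphism 'F_3 -> F}), #|F| = 3 ^ 2 ->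
     [/\ code_params (lifted iota G11) 6 5 4, APMCF (lifted iota G11) 4 30 &
         ~ UPWS (lifted iota G11)] /\
     [/\ code_params (lifted iota (dual G10)) 4 6 6, APMCF (lifted iota (dual G10)) 6 180 &
         ~ UPWS (lifted iota (dual G10))] /\
     [/\ code_params (lifted iota (dual G9)) 3 6 6, APMCF (lifted iota (dual G9)) 6 72 &
         ~ UPWS (lifted iota (dual G9))] /\
     [/\ code_params (lifted iota (dual G8)) 2 6 6, APMCF (lifted iota (dual G8)) 6 24 &
         ~ UPWS (lifted iota (dual G8))]).
Proof.
split.
  split; [|split; [|split; [|split]]].
  - have [par pmcf] := G12_params; split=> //.
    (* Lambda is constant in m, being the number of information sets of the ternary code. *)
    exists (fun=> num_info_mx 12 6 (sys_gen 6 6 T12)) => m F iota m6 cardF.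
    exact: (lifted_G12 iota cardF m6).
  - have [par pmcf] := G11_params; split=> //.
    exists (fun=> num_info_mx 11 6 (sys_gen 6 5 T11)) => m F iota m4 cardF.
    exact: (lifted_G11 iota cardF m4).
  - have [par pmcf] := G10_params; split=> //.
    by exists (fun=> 180); split=> // m F iota m3 cardF; exact: (lifted_G10 iota cardF m3).
  - have [par apmcf] := G9_params; split=> //.
    by exists (fun=> 72); split=> // m F iota m2 cardF; exact: (lifted_G9 iota cardF m2).
  have [par pmcf] := G8_params; split=> //.
  by exists (fun=> 24); split=> // m F iota m2 cardF; exact: (lifted_G8 iota cardF m2).
split; [|split; [|split]].
- have [par apmcf] := dual_G10_params; split=> //.
  move: par => [_ _]; rewrite G10E.
  exact: (not_upws_base (present11_dual 4) (valid_dual11 _) weights10_dual upws10_dual_1).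
- have [par apmcf] := dual_G9_params; split=> //.
  move: par => [_ _]; rewrite G9E.
  exact: (not_upws_base (present11_dual 3) (valid_dual11 _) weights9_dual upws9_dual_1).
- have [par apmcf] := dual_G8_params; split=> //.
  move: par => [_ _]; rewrite G8E.
  exact: (not_upws_base (present11_dual 2) (valid_dual11 _) weights8_dual upws8_dual_1).
move=> F iota cardF; split; [|split; [|split]].
- have [par apmcf] := lifted_G11_square iota cardF; split=> //.
  move: par => [_ _]; rewrite G11E.
  exact: (not_UPWS_list (present11 5) (valid_sys11 _) weights11 cardF upws11_2).
- have [//|par apmcf] := lifted_dual_G10 iota cardF; split=> //.
  move: par => [_ _]; rewrite G10E.
  exact: (not_UPWS_list (present11_dual 4) (valid_dual11 _)
    weights10_dual cardF upws10_dual_2).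
- have [//|par apmcf] := lifted_dual_G9 iota cardF; split=> //.
  move: par => [_ _]; rewrite G9E.
  exact: (not_UPWS_list (present11_dual 3) (valid_dual11 _) weights9_dual cardF upws9_dual_2).
have [//|par apmcf] := lifted_dual_G8 iota cardF; split=> //.
move: par => [_ _]; rewrite G8E.
exact: (not_UPWS_list (present11_dual 2) (valid_dual11 _) weights8_dual cardF upws8_dual_2).
Qed.
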